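(* Let $\hat\omega$ be a state on $\mathcal{O}_d$, $d\ge2$, let $(\mathcal{H},\Omega,\pi)$ be its cyclic (GNS) representation and $S_i=\pi(s_i)$. Let $\mathcal{K}\subset\mathcal{H}$ be the closed linear span of $\{S_I^*\Omega: I\in\mathcal{I}\}$, $P$ the orthogonal projection of $\mathcal{H}$ onto $\mathcal{K}$, and $V_i\in\mathcal{B}(\mathcal{K})$ given by $V_i^*=S_i^*P=PS_i^*P$ (restricted to $\mathcal{K}$). Define the endomorphism $\sigma(X)=\sum_{i=1}^dS_iXS_i^*$ of $\mathcal{B}(\mathcal{H})$ and the unital completely positive map $\boldsymbol{\sigma}(Y)=\sum_{i=1}^dV_iYV_i^*$ of $\mathcal{B}(\mathcal{K})$. The following conditions are equivalent. (i) $\hat\omega$ is pure. (ii) For $X\in\mathcal{B}(\mathcal{H})$, $\sigma(X)=X$ implies $X\in\mathbb{C}1_{\mathcal{H}}$. (iii) For $Y\in\mathcal{B}(\mathcal{K})$, $\boldsymbol{\sigma}(Y)=Y$ implies $Y\in\mathbb{C}1_{\mathcal{K}}$. (iv) $\{V_i,V_i^*: i=1,\dots,d\}$ acts irreducibly on $\mathcal{K}$, and $P\in\pi(\mathcal{O}_d)''$.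
   Context: $\mathcal{O}_d$ is the universal $C^*$-algebra generated by $s_1,\dots,s_d$ with $s_i^*s_j=\delta_{ij}1$ and $\sum_{j}s_js_j^*=1$. $\mathcal{I}$ is the set of finite sequences $I=(i_1,\dots,i_m)$ with entries in $\{1,\dots,d\}$, including the empty sequence; $S_I^*=S_{i_m}^*\cdots S_{i_1}^*$ and $S_\varnothing^*=1$. *)

(* Defs.v *)
From HB Require Import structures.
From mathcomp Require Import all_boot all_order all_algebra.
From mathcomp Require Import complex.
From mathcomp Require Import all_classical all_reals all_analysis.

Set Implicit Arguments.
Unset Strict Implicit.
Unset Printing Implicit Defensive.

Import Order.TTheory GRing.Theory Num.Theory.

Local Open Scope classical_set_scope.
Local Open Scope ring_scope.

(* The norms below take their values in R[i]: in the partial order of R[i],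
   0 <= z means that z is real and nonnegative. *)

HB.mixin Record isHilbert (R : realType) H
    of CompleteNormedModule R[i] H := {
  hdot : H -> H -> R[i] ;
  hdotP : forall (k : R[i]) x y z,
    hdot (k *: x + y) z = k * hdot x z + hdot y z ;
  hdotC : forall x y, hdot x y = Num.conj (hdot y x) ;
  sqr_normE : forall x : H, `|x| ^+ 2 = hdot x x
}.

#[short(type="hilbertType")]
HB.structure Definition Hilbert (R : realType) :=
  {H of CompleteNormedModule R[i] H & isHilbert R H}.

Arguments hdot {R s} : rename.

Section HilbertDot.
Context {R : realType} {H : hilbertType R}.

Let hdot_linear (y : H) : linear_for *%R (hdot ^~ y).
Proof. by move=> k u v; rewrite hdotP. Qed.

Let hdot_antilinear (x : H) : linear_for (Num.conj \; *%R) (hdot x).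
Proof.
by move=> k u v; rewrite hdotC hdotP rmorphD rmorphM /= (hdotC x u) (hdotC x v).
Qed.

HB.instance Definition _ :=
  bilinear_isBilinear.Build R[i] H H R[i] *%R (Num.conj \; *%R) hdot
    (hdot_linear, hdot_antilinear).

Let hdot_hermitian (x y : H) : hdot x y = (-1) ^+ false * Num.conj (hdot y x).
Proof. by rewrite expr0 mul1r -hdotC. Qed.

HB.instance Definition _ :=
  isHermitianSesquilinear.Build R[i] H false Num.conj hdot hdot_hermitian.

Let hdot_gt0 (x : H) : x != 0 -> 0 < hdot x x.
Proof. by move=> x0; rewrite -sqr_normE exprn_gt0 ?normr_gt0. Qed.

HB.instance Definition _ := isDotProduct.Build R[i] H hdot hdot_gt0.

End HilbertDot.

(* The norm and its completeness are fields here: Hierarchy Builder refuses a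
   common extension of algType and normedModType, because the structures of
   numeric domains already extend both rings and normed Z-modules. *)
HB.mixin Record isCstar (R : realType) A of GRing.Algebra R[i] A := {
  star : A -> A ;
  starK : involutive star ;
  starD : forall a b, star (a + b) = star a + star b ;
  starZ : forall (k : R[i]) a, star (k *: a) = Num.conj k *: star a ;
  starM : forall a b, star (a * b) = star b * star a ;
  cnorm : A -> R[i] ;
  cnormD_le : forall a b, cnorm (a + b) <= cnorm a + cnorm b ;
  cnormZ : forall (k : R[i]) a, cnorm (k *: a) = `|k| * cnorm a ;
  cnorm0_eq0 : forall a, cnorm a = 0 -> a = 0 ;
  cnormM_le : forall a b, cnorm (a * b) <= cnorm a * cnorm b ;
  cnorm_starM : forall a, cnorm (star a * a) = cnorm a ^+ 2 ;
  cnorm_complete : forall u : nat -> A,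
    (forall e : R[i], 0 < e -> exists N, forall m n, (N <= m)%N -> (N <= n)%N ->
       cnorm (u m - u n) < e) ->
    exists l, forall e : R[i], 0 < e -> exists N, forall n, (N <= n)%N ->
       cnorm (u n - l) < e
}.

#[short(type="cstarAlgType")]
HB.structure Definition Cstar (R : realType) :=
  {A of GRing.Algebra R[i] A & isCstar R A}.

Section CuntzAlgebra.
Context {R : realType} {d : nat}.

Definition cuntz_relations (A : cstarAlgType R) (s : 'I_d -> A) : Prop :=
  (forall i j, star (s i) * s j = (i == j)%:R) /\
  \sum_(j < d) s j * star (s j) = 1.

Definition norm_closed (A : cstarAlgType R) (B : set A) : Prop :=
  forall a, (forall e : R[i], 0 < e -> exists2 b, B b & cnorm (a - b) < e) ->
    B a.

Definition closed_star_subalgebra (A : cstarAlgType R) (B : set A) : Prop :=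
  [/\ norm_closed B, B 1, forall (k : R[i]) a b, B a -> B b -> B (k *: a + b),
      forall a b, B a -> B b -> B (a * b) & forall a, B a -> B (star a)].

Definition generates (A : cstarAlgType R) (s : 'I_d -> A) : Prop :=
  forall B : set A, closed_star_subalgebra B -> (forall i, B (s i)) ->
    B = setT.

Definition is_cuntz_algebra (A : cstarAlgType R) (s : 'I_d -> A) : Prop :=
  [/\ cuntz_relations s, generates s &
      forall (B : cstarAlgType R) (t : 'I_d -> B), cuntz_relations t ->
        exists phi : {lrmorphism A -> B},
          (forall a, phi (star a) = star (phi a)) /\
          (forall i, phi (s i) = t i)].

End CuntzAlgebra.

Section States.
Context {R : realType} {A : cstarAlgType R}.

(* Positive linear functionals of norm one: as cnorm 1 = 1 in A, the last two
   conditions amount to omega 1 = 1 = the norm of omega. *)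
Definition is_state (omega : {scalar A}) : Prop :=
  [/\ forall a, 0 <= omega (star a * a), omega 1 = 1
    & forall a, `|omega a| <= cnorm a].

Definition is_pure (omega : {scalar A}) : Prop :=
  is_state omega /\
  forall (omega1 omega2 : {scalar A}) (t : R),
    is_state omega1 -> is_state omega2 -> 0 < t < 1 ->
    (forall a, omega a = t%:C%C * omega1 a + (1 - t)%:C%C * omega2 a) ->
    omega1 =1 omega /\ omega2 =1 omega.

End States.

Section Operators.
Context {R : realType}.

Definition bounded_operator {H H' : hilbertType R} (T : H -> H') : Prop :=
  linear T /\ exists M : R[i], forall x, `|T x| <= M * `|x|.

(* By the Riesz representation theorem, for a bounded operator T the value
   adj T y is the unique z with <T x, y> = <x, z> for all x. *)
Definition adj {H H' : hilbertType R} (T : H -> H') (y : H') : H :=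
  xget 0 [set z | forall x, hdot (T x) y = hdot x z].

Definition is_scalar {H : hilbertType R} (T : H -> H) : Prop :=
  exists c : R[i], forall x, T x = c *: x.

Definition commutant {H : hilbertType R} (M : set (H -> H)) : set (H -> H) :=
  [set X | bounded_operator X /\ forall Y, M Y -> X \o Y = Y \o X].

(* X |-> \sum_i T_i X T_i^* *)
Definition cp_map {H : hilbertType R} {d : nat} (T : 'I_d -> H -> H)
    (X : H -> H) : H -> H :=
  fun x => \sum_(i < d) T i (X (adj (T i) x)).

(* T_I^* = T_{i_m}^* ... T_{i_1}^* for I = [:: i_1; ...; i_m] *)
Definition adj_word {H : hilbertType R} {d : nat} (T : 'I_d -> H -> H)
    (I : seq 'I_d) : H -> H :=
  foldl (fun X i => adj (T i) \o X) idfun I.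

Definition is_representation {A : cstarAlgType R} {H : hilbertType R}
    (pi : A -> H -> H) : Prop :=
  [/\ forall a, bounded_operator (pi a),
      forall (k : R[i]) a b x, pi (k *: a + b) x = k *: pi a x + pi b x,
      pi 1 = idfun, forall a b, pi (a * b) = pi a \o pi b
    & forall a, pi (star a) = adj (pi a)].

(* The triple (H, Omega, pi) is determined by omega up to unitary equivalence. *)
Definition is_gns {A : cstarAlgType R} (omega : {scalar A})
    (H : hilbertType R) (Omega : H) (pi : A -> H -> H) : Prop :=
  [/\ is_representation pi, closure [set pi a Omega | a in setT] = setT
    & forall a, omega a = hdot (pi a Omega) Omega].

End Operators.

Section ClosedSubspaces.
Context {R : realType}.

Record closed_subspace (H : hilbertType R) := ClosedSubspace {
  subspace_set : set H ;
  subspace_closed : closed subspace_set ;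
  subspace0 : subspace_set 0 ;
  subspaceP : forall (k : R[i]) x y,
    subspace_set x -> subspace_set y -> subspace_set (k *: x + y)
}.

Definition lin_span {H : hilbertType R} (E : set H) : set H :=
  [set x | exists n (c : 'I_n -> R[i]) (v : 'I_n -> H),
     (forall i, E (v i)) /\ x = \sum_(i < n) c i *: v i].

Lemma lin_span0 {H : hilbertType R} (E : set H) : lin_span E 0.
Proof.
by exists 0%N, (fun=> 0), (fun=> 0); split; [case|rewrite big_ord0].
Qed.

Lemma lin_spanP {H : hilbertType R} (E : set H) (k : R[i]) x y :
  lin_span E x -> lin_span E y -> lin_span E (k *: x + y).
Proof.
move=> [n [c [v [Ev ->]]]] [m [c' [v' [Ev' ->]]]].
exists (n + m)%N,
  (fun i : 'I_(n + m) =>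
     match fintype.split i with inl j => k * c j | inr j => c' j end),
  (fun i : 'I_(n + m) =>
     match fintype.split i with inl j => v j | inr j => v' j end).
split=> [i|]; first by case: (fintype.split i).
rewrite big_split_ord /= scaler_sumr; congr (_ + _).
  apply: eq_bigr => i _; rewrite -[lshift _ _]/(unsplit (inl i)) unsplitK.
  by rewrite scalerA.
by apply: eq_bigr => i _; rewrite -[rshift _ _]/(unsplit (inr i)) unsplitK.
Qed.

Lemma closure_normP {H : hilbertType R} (E : set H) x :
  closure E x <-> forall e : R[i], 0 < e -> exists2 y, E y & `|x - y| < e.
Proof.
split=> [clEx e e0|clEx B].
  have [y [Ey xy]] := clEx _ (nbhsx_ballx x _ e0).
  by exists y => //; move: xy; rewrite -ball_normE.
rewrite -nbhs_ballE => -[e /= e0 eB].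
have [y Ey xy] := clEx _ e0; exists y; split=> //.
by apply: eB; rewrite -ball_normE.
Qed.

Lemma closed_span_linear {H : hilbertType R} (E : set H) (k : R[i]) x y :
  closure (lin_span E) x -> closure (lin_span E) y ->
  closure (lin_span E) (k *: x + y).
Proof.
move=> /closure_normP clx /closure_normP cly.
apply/closure_normP => e e0.
have k0 : 0 < `|k| + 1 :> R[i] by rewrite ltr_wpDl.
have e1 : 0 < e / 2 / (`|k| + 1) by rewrite !divr_gt0.
have e2 : 0 < e / 2 by rewrite divr_gt0.
have [[x' Ex' xx'] [y' Ey' yy']] := (clx _ e1, cly _ e2).
exists (k *: x' + y'); first exact: lin_spanP.
rewrite opprD addrACA -scalerBr (le_lt_trans (ler_normD _ _))//.
rewrite [ltRHS](splitr e) ler_ltD// normrZ.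
apply: (@le_trans _ _ ((`|k| + 1) * `|x - x'|)).
  by rewrite ler_wpM2r// lerDl.
by rewrite -ler_pdivlMl// mulrC ltW.
Qed.

Definition closed_span {H : hilbertType R} (E : set H) : closed_subspace H :=
  ClosedSubspace (@closed_closure _ (lin_span E))
    (@subset_closure _ (lin_span E) _ (lin_span0 E))
    (@closed_span_linear H E).

(* By the projection theorem, orthoproj W x is the unique y in W such that
   x - y is orthogonal to W. *)
Definition orthoproj {H : hilbertType R} (W : closed_subspace H) (x : H) : H :=
  xget 0 [set y | subspace_set W y /\
    forall z, subspace_set W z -> hdot (x - y) z = 0].

Definition acts_irreducibly {H : hilbertType R} (M : set (H -> H)) : Prop :=
  forall W : closed_subspace H,
    (forall T, M T -> forall x, subspace_set W x -> subspace_set W (T x)) ->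
    subspace_set W = [set 0] \/ subspace_set W = setT.

End ClosedSubspaces.

Section SubspaceType.
Context {R : realType} {H : hilbertType R} (W : closed_subspace H).

Definition subspace_pred : pred H := fun x => x \in subspace_set W.

Record subspace_type := SubspaceElt {
  subspace_val : H ;
  subspace_valP : subspace_pred subspace_val
}.

HB.instance Definition _ := [isSub for subspace_val].
HB.instance Definition _ := [Choice of subspace_type by <:].

Lemma subspace_pred_submod : submod_closed subspace_pred.
Proof.
split; first by rewrite /in_mem/= /subspace_pred inE; exact: subspace0.
move=> k x y; rewrite /in_mem/= /subspace_pred !inE; exact: subspaceP.
Qed.

HB.instance Definition _ :=
  GRing.isSubmodClosed.Build _ _ subspace_pred subspace_pred_submod.
HB.instance Definition _ := [SubChoice_isSubLmodule of subspace_type by <:].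

Local Notation K := subspace_type.

Let norm (x : K) : R[i] := `|val x|.

Let normD (x y : K) : norm (x + y) <= norm x + norm y.
Proof. by rewrite /norm raddfD ler_normD. Qed.

Let normZ (k : R[i]) (x : K) : norm (k *: x) = `|k| * norm x.
Proof. by rewrite /norm linearZ normrZ. Qed.

Let norm0 (x : K) : norm x = 0 -> x = 0.
Proof. by move=> /normr0_eq0 x0; apply/val_inj; rewrite x0 raddf0. Qed.

HB.instance Definition _ :=
  @Lmodule_isNormed.Build R[i] subspace_type norm normD normZ norm0.

Let complete (F : set_system K) : ProperFilter F -> cauchy F -> cvg F.
Proof.
move=> FF cF.
have ballE (x y : K) (e : R[i]) : ball x e y = ball (val x) e (val y).
  by rewrite -!ball_normE /ball_ /mkset -raddfB.
have [l Fl] : exists l : H, val @ F --> l.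
  apply/cvg_ex; apply: cauchy_cvg; apply/cauchy_ballP => e e0.
  move/cauchy_ballP : cF => /(_ _ e0) [[A B]/= [FA FB] AB].
  exists (val @` A, val @` B) => /=.
    split; first by apply: filterS FA => x Ax; exists x.
    by apply: filterS FB => x Bx; exists x.
  by move=> [_ _]/= [[x Ax <-] [y By <-]]; rewrite -ballE; exact: (AB (x, y)).
have Wl : subspace_set W l.
  apply: (@subspace_closed _ _ W) => B /Fl FB.
  have [x Bx] : exists x : K, B (val x) := filter_ex (FB : F (val @^-1` B)).
  exists (val x); split=> //.
  by have := subspace_valP x; rewrite /subspace_pred inE.
have Wl' : l \in subspace_pred by rewrite /in_mem/= /subspace_pred inE.
apply/cvg_ex; exists (SubspaceElt Wl'); apply/cvg_ballP => e e0.
move/cvg_ballP : Fl => /(_ _ e0); apply: filterS => x.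
by rewrite ballE.
Qed.

HB.instance Definition _ := Uniform_isComplete.Build subspace_type complete.

Let dot (x y : K) : R[i] := hdot (val x) (val y).

Let dotP (k : R[i]) (x y z : K) :
  dot (k *: x + y) z = k * dot x z + dot y z.
Proof. by rewrite /dot linearP hdotP. Qed.

Let dotC (x y : K) : dot x y = Num.conj (dot y x).
Proof. exact: hdotC. Qed.

Let sqr_norm (x : K) : `|x| ^+ 2 = dot x x.
Proof. exact: (sqr_normE (val x)). Qed.

HB.instance Definition _ := isHilbert.Build R subspace_type dotP dotC sqr_norm.

End SubspaceType.

(* Main.v *)
(* Fixed points of sigma are the operators commuting with the S_i and S_i^*,
   hence with pi(O_d), so (i) <=> (ii) is the equivalence of purity and
   irreducibility.  Since K is invariant under the S_i^*, the projections
   E_n = sigma^n(P) increase, and their limit is fixed by sigma and fixes Omega,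
   so E_n -> 1.  If Y is a fixed point of the compressed map on K, then
   X_n = sigma^n(Y P) satisfies E_k X_m E_k = X_k for k <= m; so the vectors X_n x
   form a bounded martingale, and X = lim X_n is a fixed point of sigma with
   P X P = Y.  Conversely P X P = c P gives E_n X E_n = c E_n, whence X = c.
   For (iv) => (i), a state dominated by a multiple of omega is
   a |-> <T pi(a) Omega, Omega> with T in pi(O_d)'; as P is in pi(O_d)'', T
   commutes with P, its restriction to K commutes with the V_i and V_i^*, and
   Schur's lemma gives T Omega = c Omega.  The square root needed for Schur's
   lemma comes from the iteration T |-> (B + T^2) / 2, whose increments are
   dominated by those of the same iteration for the number 1. *)

Require Import Defs.
From HB Require Import structures.
From mathcomp Require Import all_boot all_order all_algebra.
From mathcomp Require Import complex ring lra.
From mathcomp Require Import all_classical all_reals all_analysis.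

Set Implicit Arguments.
Unset Strict Implicit.
Unset Printing Implicit Defensive.

Import Order.TTheory GRing.Theory Num.Theory.
Import numFieldNormedType.Exports.

Local Open Scope classical_set_scope.
Local Open Scope ring_scope.

Local Notation Re := complex.Re.
Local Notation Im := complex.Im.

(** * Complex-valued Hilbert norms read as real numbers *)

Section ComplexReal.
Context {R : realType}.
Implicit Types (z w : R[i]) (t : R).

Lemma ReD z w : Re (z + w) = Re z + Re w.
Proof. by case: z w => [? ?] [? ?]. Qed.

Lemma ReN z : Re (- z) = - Re z.
Proof. by case: z. Qed.

Lemma ReZ t z : Re (t%:C%C * z) = t * Re z.
Proof. by case: z => [a b] /=; rewrite mul0r subr0. Qed.

Lemma Re_conj z : Re (Num.conj z) = Re z.
Proof. by case: z. Qed.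

Lemma ReMi z : Re ('i%C * z) = - Im z.
Proof. by case: z => [a b] /=; rewrite mul0r mul1r sub0r. Qed.

Lemma ge0_ReE z : 0 <= z -> z = (Re z)%:C%C.
Proof. by move=> z0; rewrite RRe_real// ger0_real. Qed.

Lemma Re_ge0 z : 0 <= z -> 0 <= Re z.
Proof. by rewrite lecE => /andP[]. Qed.

Lemma eqC_Re z w : Re z = Re w -> Re ('i%C * z) = Re ('i%C * w) -> z = w.
Proof.
rewrite !ReMi; case: z w => [a b] [a' b'] /= -> /eqP.
by rewrite eqr_opp => /eqP ->.
Qed.

End ComplexReal.

Section HilbertReal.
Context {R : realType} {H : hilbertType R}.
Implicit Types (x y z : H) (t : R) (k : R[i]).

(** The order of [R[i]] is only partial, so estimates are carried out on real parts in [R]; passing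
    from [x] to ['i *: x] recovers the imaginary parts. *)
Definition nm x : R := Re `|x|.
Definition rdot x y : R := Re (hdot x y).

Lemma nmE x : `|x| = (nm x)%:C%C.
Proof. exact/ge0_ReE/normr_ge0. Qed.

Lemma nm_ge0 x : 0 <= nm x.
Proof. exact/Re_ge0/normr_ge0. Qed.

Lemma sqr_nm x : nm x ^+ 2 = rdot x x.
Proof. by rewrite /rdot -sqr_normE nmE -rmorphXn. Qed.

Lemma hdotxx x : hdot x x = (nm x ^+ 2)%:C%C.
Proof. by rewrite -sqr_normE nmE rmorphXn. Qed.

Lemma nm_eq0 x : nm x = 0 -> x = 0.
Proof. by move=> x0; apply/normr0_eq0; rewrite nmE x0. Qed.

Lemma nm0 : nm (0 : H) = 0.
Proof. by rewrite /nm normr0. Qed.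

Lemma nmN x : nm (- x) = nm x.
Proof. by rewrite /nm normrN. Qed.

Lemma nmB x y : nm (x - y) = nm (y - x).
Proof. by rewrite -opprB nmN. Qed.

Lemma ler_nmD x y : nm (x + y) <= nm x + nm y.
Proof. by have := ler_normD x y; rewrite !nmE -rmorphD lecR. Qed.

Lemma nmZ t x : nm (t%:C%C *: x) = `|t| * nm x.
Proof.
by rewrite /nm normrZ nmE normc_def /= expr0n addr0 sqrtr_sqr mul0r subr0.
Qed.

Lemma hdotDl x y z : hdot (x + y) z = hdot x z + hdot y z.
Proof. by rewrite linearDl. Qed.
Lemma hdotDr x y z : hdot z (x + y) = hdot z x + hdot z y.
Proof. by rewrite linearDr. Qed.
Lemma hdotZl k x y : hdot (k *: x) y = k * hdot x y.
Proof. by rewrite linearZl_LR. Qed.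
Lemma hdotZr k x y : hdot x (k *: y) = Num.conj k * hdot x y.
Proof. by rewrite linearZr_LR. Qed.

Lemma rdotC x y : rdot x y = rdot y x.
Proof. by rewrite /rdot hdotC Re_conj. Qed.

Lemma rdotDl x y z : rdot (x + y) z = rdot x z + rdot y z.
Proof. by rewrite /rdot hdotDl ReD. Qed.

Lemma rdotDr x y z : rdot z (x + y) = rdot z x + rdot z y.
Proof. by rewrite !(rdotC z) rdotDl. Qed.

Lemma rdotNl x y : rdot (- x) y = - rdot x y.
Proof. by rewrite /rdot linearNl ReN. Qed.

Lemma rdotNr x y : rdot x (- y) = - rdot x y.
Proof. by rewrite !(rdotC x) rdotNl. Qed.

Lemma rdotZl t x y : rdot (t%:C%C *: x) y = t * rdot x y.
Proof. by rewrite /rdot hdotZl ReZ. Qed.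

Lemma rdotZr t x y : rdot x (t%:C%C *: y) = t * rdot x y.
Proof. by rewrite !(rdotC x) rdotZl. Qed.

Lemma rdot0l x : rdot 0 x = 0.
Proof. by rewrite /rdot linear0l. Qed.

Lemma rdot_suml n (f : 'I_n -> H) x :
  rdot (\sum_(i < n) f i) x = \sum_(i < n) rdot (f i) x.
Proof. by elim/big_ind2: _ => [|a b c e <- <-|//]; rewrite (rdot0l, rdotDl). Qed.

Lemma rdot_sumr n (f : 'I_n -> H) x :
  rdot x (\sum_(i < n) f i) = \sum_(i < n) rdot x (f i).
Proof. by rewrite rdotC rdot_suml; apply: eq_bigr => i _; rewrite rdotC. Qed.

Lemma rdot_ext x y : (forall z, rdot z x = rdot z y) -> x = y.
Proof.
move=> xy; apply/eqP; rewrite -subr_eq0; apply/eqP/nm_eq0/eqP.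
by rewrite -sqrf_eq0 sqr_nm rdotDr rdotNr xy subrr.
Qed.

Lemma rdot_i x y : rdot ('i%C *: x) y = - rdot x ('i%C *: y).
Proof.
rewrite /rdot hdotZl hdotZr; case: (hdot x y) => a b /=.
by ring.
Qed.

Definition rdotE :=
  (rdotDl, rdotDr, rdotNl, rdotNr, rdotZl, rdotZr).

(** Cauchy-Schwarz: expand the square of the norm of [nm y * x - nm x * y] and divide by
    [nm x * nm y]. *)
Lemma rdot_le_nm x y : rdot x y <= nm x * nm y.
Proof.
have [x0|x0] := eqVneq (nm x) 0.
  by rewrite (nm_eq0 x0) rdot0l nm0 mul0r.
have [y0|y0] := eqVneq (nm y) 0.
  by rewrite (nm_eq0 y0) rdotC rdot0l nm0 mulr0.
have xy0 : 0 < nm x * nm y.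
  by rewrite mulr_gt0// lt_neqAle nm_ge0 eq_sym andbT.
have := sqr_ge0 (nm ((nm y)%:C%C *: x - (nm x)%:C%C *: y)).
rewrite sqr_nm !rdotE (rdotC y x) -!sqr_nm => h.
by rewrite -(ler_pM2l xy0); nra.
Qed.

Lemma normr_rdot_le x y : `|rdot x y| <= nm x * nm y.
Proof.
by rewrite ler_norml rdot_le_nm andbT lerNl -rdotNl -[nm x]nmN rdot_le_nm.
Qed.

Lemma cvg_nmP (u : nat -> H) (l : H) :
  u @ \oo --> l <->
  forall e : R, 0 < e -> exists N, forall n, (N <= n)%N -> nm (u n - l) < e.
Proof.
split=> [ul e e0|ul].
  have : 0 < e%:C%C :> R[i] by rewrite ltcR.
  move/cvgrPdist_lt : ul => /[apply] -[N _ uN].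
  by exists N => n /uN /=; rewrite nmE ltcR nmB.
apply/cvgrPdist_lt => e e0.
have Re0 : 0 < Re e by move: e0; rewrite ltcE => /andP[].
have [N uN] := ul _ Re0; exists N => // n /uN /=.
by rewrite (ge0_ReE (ltW e0)) nmE ltcR nmB.
Qed.

Lemma cauchy_nm_cvg (u : nat -> H) :
  (forall e : R, 0 < e -> exists N, forall m n, (N <= m)%N -> (N <= n)%N ->
     nm (u m - u n) < e) ->
  exists l : H, u @ \oo --> l.
Proof.
move=> uC; apply/cvg_ex; apply: cauchy_cvg; apply/cauchy_ballP => e e0.
have Re0 : 0 < Re e by move: e0; rewrite ltcE => /andP[].
have [N uN] := uC _ Re0.
exists ([set u n | n in [set n | (N <= n)%N]],
        [set u n | n in [set n | (N <= n)%N]]) => /=.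
  by split; exists N => // n Nn; exists n.
move=> [_ _] /= [[m Nm <-] [n Nn <-]].
by rewrite -ball_normE /= (ge0_ReE (ltW e0)) nmE ltcR; exact: uN.
Qed.

Lemma closure_nmP (E : set H) x :
  closure E x <-> forall e : R, 0 < e -> exists2 y, E y & nm (x - y) < e.
Proof.
split=> [/closure_normP clE e e0|clE].
  have [|y Ey] := clE e%:C%C; first by rewrite ltcR.
  by rewrite nmE ltcR; exists y.
apply/closure_normP => e e0.
have Re0 : 0 < Re e by move: e0; rewrite ltcE => /andP[].
have [y Ey xy] := clE _ Re0; exists y => //.
by rewrite (ge0_ReE (ltW e0)) nmE ltcR.
Qed.

Lemma cvg_nm_unique (u : nat -> H) (l l' : H) :
  u @ \oo --> l -> u @ \oo --> l' -> l = l'.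
Proof. by move=> ul ul'; exact: (cvg_unique (@norm_hausdorff _ _) ul ul'). Qed.

Lemma cvg_rdotr (u : nat -> H) (l y : H) :
  u @ \oo --> l -> (fun n => rdot y (u n)) @ \oo --> rdot y l.
Proof.
move=> /cvg_nmP ul; apply/cvgrPdist_lt => e e0.
have y0 : 0 < nm y + 1 by rewrite ltr_wpDl// nm_ge0.
have [N uN] := ul (e / (nm y + 1)) (divr_gt0 e0 y0).
exists N => // n /uN /=; rewrite ltr_pdivlMr// => un.
rewrite -rdotNr -rdotDr (le_lt_trans (normr_rdot_le _ _))// nmB.
by apply: le_lt_trans un; rewrite mulrC ler_wpM2l ?nm_ge0// lerDl.
Qed.

End HilbertReal.

(** As [j] need be neither injective nor onto, this serves for [H], for a closed subspace and for
    [a |-> pi a Omega] alike. The representing vector is the limit of [j] along a minimising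
    sequence of [nm (j a) ^+ 2 - 2 * Re (f a)]. *)
Lemma riesz {R : realType} {H : hilbertType R} (L : lmodType R[i])
    (j : L -> H) (f : L -> R[i]) (M : R) :
  linear j -> scalar f -> (forall a, Re (f a) <= M * nm (j a)) ->
  exists z, forall a, f a = hdot (j a) z.
Proof.
move=> jL fL fM.
have jD a b : j (a + b) = j a + j b by rewrite -[a in LHS]scale1r jL scale1r.
have j0 : j 0 = 0 by apply/(addIr (j 0)); rewrite -jD !add0r.
have jZ k a : j (k *: a) = k *: j a by rewrite -[X in j X]addr0 jL j0 addr0.
clear j0.
have fD a b : f (a + b) = f a + f b by rewrite -[a in LHS]scale1r fL mul1r.
have f0 : f 0 = 0 by apply/(addIr (f 0)); rewrite -fD !add0r.
have fZ k a : f (k *: a) = k * f a by rewrite -[X in f X]addr0 fL f0 addr0.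
clear f0.
suff [z zf] : exists z, forall a, Re (f a) = rdot (j a) z.
  by exists z => a; apply: eqC_Re; rewrite -?fZ -?hdotZl -?jZ zf.
pose J a := nm (j a) ^+ 2 - 2 * Re (f a).
have J_ge a : - M ^+ 2 <= J a.
  have := sqr_ge0 (nm (j a) - M); have := fM a; rewrite /J; nra.
have hasJ : has_inf (range J).
  by split; [exists (J 0), 0|exists (- M ^+ 2) => _ [a _ <-]].
pose I := inf (range J).
have I_le a : I <= J a by apply: ge_inf; [case: hasJ|exists a].
(* Parallelogram law: the linear terms cancel, and [J] at the midpoint is at least [I]. With
   [J (a n) < I + 1/(n+1)] the squared distance is below [2 * (1/(m+1) + 1/(n+1))], whence the
   threshold [e ^+ 2 / 4] below. *)
have Jpar a b : nm (j a - j b) ^+ 2 =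
    2 * (J a + J b) - 4 * J ((2^-1)%:C%C *: (a + b)).
  rewrite /J !sqr_nm jZ jD fZ fD ReZ ReD !rdotE (rdotC (j b) (j a)). by field.
have /choice[a aJ] : forall n : nat, exists a, J a < I + n.+1%:R^-1.
  move=> n; have n0 : 0 < n.+1%:R^-1 :> R by rewrite invr_gt0.
  by have [_ [a _ <-]] := inf_adherent n0 hasJ; exists a.
have [z az] : exists z : H, j \o a @ \oo --> z.
  apply: cauchy_nm_cvg => e e0.
  have e4 : 0 < e ^+ 2 / 4 by rewrite divr_gt0 ?exprn_gt0.
  have [N _ HN] := near_infty_natSinv_lt (PosNum e4).
  exists N => m n /HN /= Hm /HN /= Hn.
  rewrite -(@ltr_pXn2r _ 2) ?nnegrE ?nm_ge0 ?ltW// Jpar.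
  have := I_le ((2^-1)%:C%C *: (a m + a n)).
  have := aJ m; have := aJ n; move: Hm Hn.
  move: (J _) (J (a m)) (J (a n)) (m.+1%:R^-1) (n.+1%:R^-1) (e ^+ 2) => *.
  lra.
exists z => v.
pose g := rdot (j v) z - Re (f v).
(* First variation: compare [J] at [a n] with [J] at [a n + t v], then let [n] grow. *)
have g_ge t : 0 <= t ^+ 2 * nm (j v) ^+ 2 + 2 * t * g.
  pose s n := t ^+ 2 * nm (j v) ^+ 2 +
    2 * t * (rdot (j v) (j (a n)) - Re (f v)) + n.+1%:R^-1.
  have s_ge n : 0 <= s n.
    have := I_le (a n + t%:C%C *: v); have := aJ n.
    rewrite /s /J jD jZ fD fZ ReD ReZ !sqr_nm !rdotE (rdotC (j v) (j (a n))).
    by move: n.+1%:R^-1 => ?; lra.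
  have sl : s @ \oo --> t ^+ 2 * nm (j v) ^+ 2 + 2 * t * g + 0.
    apply: cvgD; last exact: cvg_harmonic.
    apply: cvgD; first exact: cvg_cst.
    apply: cvgMr; apply: cvgB; last exact: cvg_cst.
    exact: cvg_rdotr.
  rewrite -[leRHS]addr0; apply: (cvgr_to_ge sl).
  by near=> n; exact: s_ge.
(* The optimal [t] would divide by [nm (j v) ^+ 2], which may vanish. With 1 added to the
   denominator, the quadratic is still negative unless [g = 0]. *)
have := g_ge (- g / (nm (j v) ^+ 2 + 1)).
have N0 : 0 < nm (j v) ^+ 2 + 1 by rewrite ltr_wpDl ?sqr_ge0.
set N := nm (j v) ^+ 2 in N0 *.
have -> : (- g / (N + 1)) ^+ 2 * N + 2 * (- g / (N + 1)) * g =
  - (g ^+ 2 * (N + 2)) / (N + 1) ^+ 2 by field; rewrite gt_eqF.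
rewrite pmulr_lge0 ?invr_gt0 ?exprn_gt0// oppr_ge0 => h.
have : g ^+ 2 <= 0 by rewrite -(@pmulr_lle0 _ (N + 2))//; lra.
rewrite real_exprn_even_le0 ?num_real//= => /eqP; rewrite /g; lra.
Unshelve. all: by end_near.
Qed.

(** * Bounded operators, adjoints and projections *)

Section Linear.
Context {R : realType} {U V : lmodType R[i]} (T : U -> V).
Hypothesis TL : linear T.

Lemma linD x y : T (x + y) = T x + T y.
Proof. by rewrite -[x in LHS]scale1r TL scale1r. Qed.

Lemma lin0 : T 0 = 0.
Proof. by apply/(addIr (T 0)); rewrite -linD !add0r. Qed.

Lemma linZ k x : T (k *: x) = k *: T x.
Proof. by rewrite -[X in T X]addr0 TL lin0 addr0. Qed.

Lemma linN x : T (- x) = - T x.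
Proof. by rewrite -scaleN1r linZ scaleN1r. Qed.

Lemma linB x y : T (x - y) = T x - T y.
Proof. by rewrite linD linN. Qed.

Lemma lin_sum n (f : 'I_n -> U) : T (\sum_(i < n) f i) = \sum_(i < n) T (f i).
Proof. by elim/big_ind2: _ => [|a b c e <- <-|//]; rewrite (lin0, linD). Qed.

End Linear.

Section BoundedOperators.
Context {R : realType}.
Implicit Types (H : hilbertType R) (t : R) (k : R[i]).

Lemma bounded_nmP {H H' : hilbertType R} (T : H -> H') :
  bounded_operator T <->
  linear T /\ exists2 M : R, 0 <= M & forall x, nm (T x) <= M * nm x.
Proof.
split=> [[TL [M TM]]|[TL [M M0 TM]]]; split=> //; last first.
  by exists M%:C%C => x; rewrite !nmE -rmorphM lecR.
exists `|Re M| => // x; have := TM x.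
rewrite !nmE lecE => /andP[_ /=].
case: M {TM} => a b /= h; apply: le_trans h _.
by rewrite mulr0 subr0 ler_wpM2r ?nm_ge0// ler_norm.
Qed.

Lemma operator_linear {H H' : hilbertType R} (T : H -> H') :
  bounded_operator T -> linear T.
Proof. by case. Qed.

Lemma bounded_comp {H H' H'' : hilbertType R} (T : H' -> H'') (T' : H -> H') :
  bounded_operator T -> bounded_operator T' -> bounded_operator (T \o T').
Proof.
move=> /bounded_nmP[TL [M M0 TM]] /bounded_nmP[TL' [M' M0' TM']].
apply/bounded_nmP; split=> [k x y /=|]; first by rewrite TL' TL.
exists (M * M') => [|x /=]; first by rewrite mulr_ge0.
by rewrite (le_trans (TM _))// -mulrA ler_wpM2l.
Qed.

Lemma bounded_id {H} : bounded_operator (@idfun H).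
Proof.
apply/bounded_nmP; split=> [//|]; exists 1 => // x.
by rewrite mul1r.
Qed.

Lemma bounded_zero {H H' : hilbertType R} :
  bounded_operator (fun _ : H => 0 : H').
Proof.
apply/bounded_nmP; split=> [k x y|]; first by rewrite scaler0 addr0.
by exists 0 => // x; rewrite nm0 mul0r.
Qed.

Lemma bounded_add {H H' : hilbertType R} (T T' : H -> H') :
  bounded_operator T -> bounded_operator T' ->
  bounded_operator (fun x => T x + T' x).
Proof.
move=> /bounded_nmP[TL [M M0 TM]] /bounded_nmP[TL' [M' M0' TM']].
apply/bounded_nmP; split=> [k x y /=|].
  by rewrite TL' TL scalerDr addrACA.
exists (M + M') => [|x /=]; first by rewrite addr_ge0.
by rewrite (le_trans (ler_nmD _ _))// mulrDl lerD.
Qed.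

Lemma nm_scale {H} k (x : H) : nm (k *: x) = Re `|k| * nm x.
Proof. by rewrite {1}/nm normrZ nmE normc_def /= mul0r subr0. Qed.

Lemma bounded_scale {H H' : hilbertType R} k (T : H -> H') :
  bounded_operator T -> bounded_operator (fun x => k *: T x).
Proof.
move=> /bounded_nmP[TL [M M0 TM]]; apply/bounded_nmP.
split=> [k' x y /=|]; first by rewrite TL scalerDr !scalerA mulrC.
exists (Re `|k| * M) => [|x].
  by rewrite mulr_ge0// Re_ge0.
by rewrite nm_scale -mulrA ler_wpM2l// Re_ge0.
Qed.

Lemma bounded_sum {H H' : hilbertType R} n (T : 'I_n -> H -> H') :
  (forall i, bounded_operator (T i)) ->
  bounded_operator (fun x => \sum_(i < n) T i x).
Proof.
elim: n T => [|n IH] T Tb.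
  have -> : (fun x => \sum_(i < 0) T i x) = (fun _ => 0).
    by apply/funext => x; rewrite big_ord0.
  exact: bounded_zero.
under eq_fun do rewrite big_ord_recl.
by apply: bounded_add => //; apply: IH.
Qed.

Lemma cvg_operator {H H' : hilbertType R} (T : H -> H') (u : nat -> H) (l : H) :
  bounded_operator T -> u @ \oo --> l -> (T \o u) @ \oo --> T l.
Proof.
move=> /bounded_nmP[TL [M M0 TM]] /cvg_nmP ul; apply/cvg_nmP => e e0.
have M1 : 0 < M + 1 by rewrite ltr_wpDl.
have [N uN] := ul _ (divr_gt0 e0 M1).
exists N => n /uN; rewrite ltr_pdivlMr// => un /=.
rewrite -linB// (le_lt_trans (TM _))//.
by apply: le_lt_trans un; rewrite mulrC ler_wpM2l ?nm_ge0// lerDl.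
Qed.

Lemma cvg_sum_nm {H} n (u : 'I_n -> nat -> H) (l : 'I_n -> H) :
  (forall i, u i @ \oo --> l i) ->
  (fun m => \sum_(i < n) u i m) @ \oo --> \sum_(i < n) l i.
Proof.
elim: n u l => [|n IH] u l ul.
  rewrite big_ord0; under eq_fun do rewrite big_ord0.
  exact: cvg_cst.
rewrite big_ord_recl; under eq_fun do rewrite big_ord_recl.
by apply: cvgD => //; apply: IH => i; exact: ul.
Qed.

End BoundedOperators.

Section Adjoint.
Context {R : realType}.

(** Riesz for [x |-> <T x, y>] shows that the set from which [adj] picks is inhabited, so the
    default value of [xget] is not reached. *)
Lemma adj_hdot {H H' : hilbertType R} (T : H -> H') x y :
  bounded_operator T -> hdot (T x) y = hdot x (adj T y).
Proof.
move=> /bounded_nmP[TL [M M0 TM]].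
have [|k a b|a|z zP] := @riesz R H H idfun (fun x => hdot (T x) y) (M * nm y).
- by [].
- by rewrite TL hdotP.
- rewrite (le_trans (rdot_le_nm (T a) y))// mulrAC ler_wpM2r ?nm_ge0//.
have : [set z | forall x, hdot (T x) y = hdot x z] z by [].
by move/(xgetI 0) => /= h; exact: h.
Qed.

Lemma adj_rdot {H H' : hilbertType R} (T : H -> H') x y :
  bounded_operator T -> rdot (T x) y = rdot x (adj T y).
Proof. by move=> Tb; rewrite /rdot adj_hdot. Qed.

Lemma adj_eq {H H' : hilbertType R} (T : H -> H') y z :
  bounded_operator T -> (forall x, rdot (T x) y = rdot x z) -> adj T y = z.
Proof. by move=> Tb Tz; apply: rdot_ext => x; rewrite -adj_rdot. Qed.

Lemma adj_rdotV {H H' : hilbertType R} (T : H -> H') x y :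
  bounded_operator T -> rdot (adj T x) y = rdot x (T y).
Proof. by move=> Tb; rewrite rdotC -adj_rdot// rdotC. Qed.

Lemma adj_bounded {H H' : hilbertType R} (T : H -> H') :
  bounded_operator T -> bounded_operator (adj T).
Proof.
move=> Tb; have /bounded_nmP[TL [M M0 TM]] := Tb; apply/bounded_nmP; split.
  move=> k x y; apply: rdot_ext => z.
  rewrite -adj_rdot// !rdotDr -[in RHS]adj_rdot//; congr (_ + _).
  rewrite /rdot !hdotZr -adj_hdot//.
exists M => // y; have [/nm_eq0 ->|T0] := eqVneq (nm (adj T y)) 0.
  by rewrite nm0 mulr_ge0// nm_ge0.
have T1 : 0 < nm (adj T y) by rewrite lt_neqAle eq_sym T0 nm_ge0.
rewrite -(ler_pM2l T1) -expr2 sqr_nm -adj_rdot//.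
rewrite (le_trans (rdot_le_nm _ _))// mulrA ler_wpM2r ?nm_ge0//.
by rewrite mulrC TM.
Qed.

Lemma adjK {H H' : hilbertType R} (T : H -> H') :
  bounded_operator T -> adj (adj T) = T.
Proof.
move=> Tb; apply/funext => x.
by apply: adj_eq; [exact: adj_bounded|move=> y; rewrite adj_rdotV].
Qed.

End Adjoint.

(** * Orthogonal projections onto closed subspaces *)

Section Projection.
Context {R : realType} {H : hilbertType R} (W : closed_subspace H).
Local Notation P := (orthoproj W).
Local Notation inW := (subspace_set W).

Lemma subspace_valW (x : subspace_type W) : inW (val x).
Proof. by have := subspace_valP x; rewrite /subspace_pred inE. Qed.

Lemma subspaceE x (Wx : inW x) : x \in subspace_pred W.
Proof. by rewrite /in_mem/= /subspace_pred inE. Qed.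

(** Projection theorem: [W] is itself a Hilbert space, and Riesz on [W] represents [w |-> <w, x>] by
    a vector that [orthoproj] can pick. *)
Lemma orthoprojP x : inW (P x) /\ forall z, inW z -> hdot (x - P x) z = 0.
Proof.
have [|k a b|a|z zP] := @riesz R (subspace_type W) (subspace_type W) idfun
  (fun w => hdot (val w) x) (nm x).
- by [].
- by rewrite linearP hdotP.
- by rewrite (le_trans (rdot_le_nm (val a) x))// mulrC.
have : [set y | inW y /\ forall z, inW z -> hdot (x - y) z = 0] (val z).
  split=> [|w Ww]; first exact: subspace_valW.
  have wxz : hdot w x = hdot w (val z) := zP (SubspaceElt (subspaceE Ww)).
  by rewrite linearBl /= hdotC wxz -hdotC subrr.
by move/(xgetI 0).
Qed.

Lemma orthoproj_in x : inW (P x).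
Proof. by case: (orthoprojP x). Qed.
#[local] Hint Resolve orthoproj_in : core.

Lemma subspaceD x y : inW x -> inW y -> inW (x + y).
Proof. by move=> Wx Wy; rewrite -[x]scale1r; exact: subspaceP. Qed.

Lemma subspaceZ k x : inW x -> inW (k *: x).
Proof.
by move=> Wx; rewrite -[_ *: _]addr0; apply: subspaceP => //; exact: subspace0.
Qed.

Lemma subspaceB x y : inW x -> inW y -> inW (x - y).
Proof.
by move=> Wx Wy; apply: subspaceD => //; rewrite -scaleN1r; exact: subspaceZ.
Qed.

Lemma orthoproj_rdot x z : inW z -> rdot (P x) z = rdot x z.
Proof.
move=> Wz; have [_ /(_ _ Wz) h] := orthoprojP x.
apply/esym/eqP; rewrite -subr_eq0 -rdotNl -rdotDl /rdot h//.
Qed.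

Lemma orthoproj_eq x y :
  inW y -> (forall z, inW z -> rdot x z = rdot y z) -> P x = y.
Proof.
move=> Wy xy; apply/eqP; rewrite -subr_eq0; apply/eqP/nm_eq0/eqP.
have WPxy : inW (P x - y) by apply: subspaceB => //; exact: orthoproj_in.
by rewrite -sqrf_eq0 sqr_nm rdotDl rdotNl orthoproj_rdot// xy// subrr.
Qed.

Lemma orthoproj_id x : inW x -> P x = x.
Proof. by move=> Wx; exact: orthoproj_eq. Qed.

Lemma orthoproj_sym x y : rdot (P x) y = rdot x (P y).
Proof.
rewrite -(orthoproj_rdot x (orthoproj_in y)) [RHS]rdotC.
by rewrite [RHS]orthoproj_rdot// rdotC.
Qed.

Lemma orthoproj_bounded : bounded_operator P.
Proof.
apply/bounded_nmP; split=> [k x y|].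
  apply: orthoproj_eq => [|z Wz].
    by apply: subspaceP; exact: orthoproj_in.
  rewrite !rdotDl orthoproj_rdot//; congr (_ + _).
  have [_ /(_ _ Wz)] := orthoprojP x.
  rewrite linearBl => /eqP; rewrite subr_eq0 => /eqP h.
  by rewrite /rdot !hdotZl h.
exists 1 => // x; rewrite mul1r.
have [->|T0] := eqVneq (nm (P x)) 0; first exact: nm_ge0.
have T1 : 0 < nm (P x) by rewrite lt_neqAle eq_sym T0 nm_ge0.
rewrite -(ler_pM2r T1) -expr2 sqr_nm orthoproj_rdot//.
exact: rdot_le_nm.
Qed.

Lemma orthoproj_comm (T : H -> H) :
  bounded_operator T -> (forall x, inW x -> inW (T x)) ->
  (forall x, inW x -> inW (adj T x)) -> forall x, P (T x) = T (P x).
Proof.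
move=> Tb WT WT' x; apply: orthoproj_eq => [|z Wz].
  exact/WT/orthoproj_in.
by rewrite !(adj_rdot _ _ Tb) orthoproj_rdot//; exact: WT'.
Qed.

Lemma closed_nm x :
  (forall e : R, 0 < e -> exists2 y, inW y & nm (x - y) < e) -> inW x.
Proof. by move=> h; apply: (@subspace_closed _ _ W); exact/closure_nmP. Qed.

End Projection.

(** * Closed spans and strong limits of operators *)

Section SpanLimits.
Context {R : realType} {H : hilbertType R}.

Lemma closed_span_sub (E : set H) : E `<=` subspace_set (closed_span E).
Proof.
move=> x Ex; apply: subset_closure; exists 1%N, (fun=> 1), (fun=> x).
by split=> //; rewrite big_ord1 scale1r.
Qed.

Lemma closed_span_map (E : set H) (W : closed_subspace H) (T : H -> H) :
  bounded_operator T -> (forall x, E x -> subspace_set W (T x)) ->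
  forall x, subspace_set (closed_span E) x -> subspace_set W (T x).
Proof.
move=> /bounded_nmP[TL [M M0 TM]] TE x /closure_nmP clx.
apply: closed_nm => e e0.
have M1 : 0 < M + 1 by rewrite ltr_wpDl.
have [_ [n [c [v [Ev ->]]]]] := clx _ (divr_gt0 e0 M1).
rewrite ltr_pdivlMr//; set y := \sum_(i < n) _ => xy.
exists (T y).
  rewrite /y lin_sum//; elim/big_ind: _ => [||i _].
  - exact: subspace0.
  - by move=> a b; exact: subspaceD.
  - by rewrite linZ//; apply: subspaceZ; exact: TE.
rewrite -linB// (le_lt_trans (TM _))//.
by apply: le_lt_trans xy; rewrite mulrC ler_wpM2l ?nm_ge0// lerDl.
Qed.

(** Uniform boundedness carries the Cauchy property from the dense set [E] to every vector; the
    limit operator inherits the bound [M]. *)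
Lemma strong_limit (T : nat -> H -> H) (M : R) (E : set H) :
  (forall n, linear (T n)) -> 0 <= M ->
  (forall n x, nm (T n x) <= M * nm x) -> (forall x, closure E x) ->
  (forall x, E x -> exists l : H, T ^~ x @ \oo --> l) ->
  exists2 T', bounded_operator T' & forall x, T ^~ x @ \oo --> T' x.
Proof.
move=> TL M0 TM dE TE.
have Tcvg x : exists l : H, T ^~ x @ \oo --> l.
  apply: cauchy_nm_cvg => e e0.
  (* The difference [T m x - T n x] splits into four terms, each allotted [e / 4]; the 1 covers
     [M = 0]. *)
  have M4 : 0 < 4 * (M + 1) by rewrite mulr_gt0// ltr_wpDl.
  have /closure_nmP/(_ _ (divr_gt0 e0 M4))[y Ey] := dE x.
  rewrite ltr_pdivlMr// => xy.
  have Mxy : M * nm (x - y) <= e / 4.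
    by clear TL; have := nm_ge0 (x - y); lra.
  have [l /cvg_nmP/(_ (e / 4))[|N HN]] := TE _ Ey; first by rewrite divr_gt0.
  exists N => m n /HN Hm /HN Hn.
  have -> : T m x - T n x =
      T m (x - y) + (T m y - l) + (l - T n y) - T n (x - y).
    by rewrite !(linB (TL _)) !subrKA opprB subrKA.
  rewrite (le_lt_trans (ler_nmD _ _))// nmN.
  have := ler_nmD (T m (x - y) + (T m y - l)) (l - T n y).
  have := ler_nmD (T m (x - y)) (T m y - l).
  have := TM m (x - y); have := TM n (x - y).
  move: Hn Hm Mxy; rewrite [nm (T n y - l)]nmB; clear.
  move: (nm _) (nm _) (nm _) (nm _) (nm _) (nm _) (M * _) => *.
  lra.
have [T' T'P] := choice Tcvg; exists T' => //.
apply/bounded_nmP; split=> [k x y|].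
  apply: (cvg_nm_unique (T'P _)).
  under eq_fun do rewrite TL.
  apply: cvgD => //.
  by apply: (cvg_operator (T := fun x => k *: x)) => //; apply: bounded_scale bounded_id.
exists M => // x; rewrite leNgt; apply/negP => h.
have /cvg_nmP/(_ (nm (T' x) - M * nm x))[|N HN] := T'P x; first by rewrite subr_gt0.
have := HN _ (leqnn N); have := TM N x.
have := ler_nmD (T N x) (T' x - T N x); rewrite addrC subrK nmB.
by lra.
Qed.

End SpanLimits.

(** * Square roots of contractions and Schur's lemma *)

Section SquareRoot.
Context {R : realType} {H : hilbertType R}.
Variable B : H -> H.
Hypotheses (BL : linear B) (B1 : forall x, nm (B x) <= nm x).

(** A fixed point [T = (B + T^2) / 2] satisfies [(1 - T)^2 = 1 - B]. *)
Fixpoint sqrt_iter n : H -> H :=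
  if n is m.+1 then fun x => (2^-1)%:C%C *: (B x + sqrt_iter m (sqrt_iter m x))
  else fun _ => 0.

Fixpoint majorant n : R := if n is m.+1 then (1 + majorant m ^+ 2) / 2 else 0.

Lemma majorant_itv n : 0 <= majorant n <= 1.
Proof. by elim: n => [|n /andP[h0 h1]] /=; [rewrite lexx ler01|nra]. Qed.

Lemma majorant_nd : nondecreasing_seq majorant.
Proof.
apply/nondecreasing_seqP => n /=; have /andP[h0 h1] := majorant_itv n.
by have := sqr_ge0 (1 - majorant n); nra.
Qed.

Lemma sqrt_iter_linear n : linear (sqrt_iter n).
Proof.
elim: n => [|n IH] k x y /=; first by rewrite scaler0 addr0.
by rewrite BL !IH addrACA -scalerDr [LHS]scalerDr !scalerA mulrC.
Qed.

Lemma sqrt_iter_comm (T : H -> H) : linear T ->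
  (forall x, T (B x) = B (T x)) ->
  forall n x, T (sqrt_iter n x) = sqrt_iter n (T x).
Proof.
move=> TL TB; elim=> [|n IH] x /=; first exact: lin0.
by rewrite linZ// linD// TB !IH.
Qed.

Lemma sqrt_iter_le n x : nm (sqrt_iter n x) <= majorant n * nm x.
Proof.
elim: n x => [|n IH] x /=; first by rewrite nm0 mul0r.
have /andP[h0 h1] := majorant_itv n.
rewrite nmZ ger0_norm ?invr_ge0//.
rewrite [X in _ <= X * _]mulrC -mulrA ler_pM2l ?invr_gt0// mulrDl mul1r.
rewrite (le_trans (ler_nmD _ _))// lerD// (le_trans (IH _))//.
by rewrite expr2 -mulrA ler_wpM2l.
Qed.

(** The iterates commute, so the difference of two consecutive squares factors as
    [(T' + T) (T' - T)]. The majorants factor in the same way, and the induction bounds each factor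
    by its numerical counterpart. *)
Lemma sqrt_iterS_sub n x :
  nm (sqrt_iter n.+1 x - sqrt_iter n x) <=
  (majorant n.+1 - majorant n) * nm x.
Proof.
elim: n x => [|n IH] x.
  by rewrite subr0 subr0; exact: (sqrt_iter_le 1).
have -> : sqrt_iter n.+2 x - sqrt_iter n.+1 x = (2^-1)%:C%C *:
    (sqrt_iter n.+1 (sqrt_iter n.+1 x - sqrt_iter n x) +
     sqrt_iter n (sqrt_iter n.+1 x - sqrt_iter n x)).
  rewrite !(linB (sqrt_iter_linear _)) [sqrt_iter n (sqrt_iter n.+1 x)]
    (sqrt_iter_comm (sqrt_iter_linear n)); last first.
    by move=> y; rewrite -(sqrt_iter_comm BL).
  rewrite subrKA [sqrt_iter n.+2 x]/= -/(sqrt_iter n.+1).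
  rewrite [X in _ - X = _]/= -scalerBr opprD addrACA subrr add0r.
  by [].
rewrite nmZ ger0_norm ?invr_ge0//.
have /andP[h0 h1] := majorant_itv n; have /andP[h2 h3] := majorant_itv n.+1.
have -> : (majorant n.+2 - majorant n.+1) * nm x =
    2^-1 * (majorant n.+1 * ((majorant n.+1 - majorant n) * nm x) +
            majorant n * ((majorant n.+1 - majorant n) * nm x)).
  by move: (erefl : majorant n.+2 = (1 + majorant n.+1 ^+ 2) / 2) => ->;
    move: (erefl : majorant n.+1 = (1 + majorant n ^+ 2) / 2) => ->; field.
rewrite ler_pM2l ?invr_gt0// (le_trans (ler_nmD _ _))//.
by rewrite lerD// (le_trans (sqrt_iter_le _ _))// ler_wpM2l.
Qed.

Lemma sqrt_iter_sub m n x : (m <= n)%N ->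
  nm (sqrt_iter n x - sqrt_iter m x) <= (majorant n - majorant m) * nm x.
Proof.
move=> /subnK <-; elim: (n - m)%N => [|k IH].
  by rewrite add0n !subrr nm0 mul0r.
rewrite addSn -(subrKA (sqrt_iter (k + m) x)) (le_trans (ler_nmD _ _))//.
rewrite -[X in _ <= X * _](subrKA (majorant (k + m))) mulrDl lerD//.
exact: sqrt_iterS_sub.
Qed.

(* [1 - T] is a square root of [1 - B]. *)
Lemma contraction_sqrt : exists T : H -> H,
  [/\ bounded_operator T, forall x, nm (T x) <= nm x,
      forall x, x - T x - T (x - T x) = x - B x
    & forall X : H -> H, bounded_operator X ->
        (forall x, X (B x) = B (X x)) -> forall x, X (T x) = T (X x)].
Proof.
have iter1 n x : nm (sqrt_iter n x) <= 1 * nm x.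
  rewrite (le_trans (sqrt_iter_le _ _))// ler_wpM2r ?nm_ge0//.
  by have /andP[] := majorant_itv n.
have [||T Tb TP] := @strong_limit _ _ sqrt_iter 1 setT sqrt_iter_linear ler01 iter1.
- by move=> x; exact: subset_closure.
- move=> x _; apply: cauchy_nm_cvg => e e0.
  have x1 : 0 < 2 * (nm x + 1) by rewrite mulr_gt0// ltr_wpDl ?nm_ge0.
  have ub : has_ubound (range majorant).
    by exists 1 => _ [n _ <-]; have /andP[] := majorant_itv n.
  have := nondecreasing_cvgn majorant_nd ub.
  move/cvgrPdist_lt => /(_ _ (divr_gt0 e0 x1))[N _ HN].
  have Hn n : (N <= n)%N -> nm (sqrt_iter n x - sqrt_iter N x) < e / 2.
    move=> Nn; rewrite (le_lt_trans (sqrt_iter_sub _ Nn))//.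
    have : 0 <= majorant n - majorant N by rewrite subr_ge0 majorant_nd.
    have := HN _ (leqnn N); rewrite /= ger0_norm; last first.
      by rewrite subr_ge0; apply: ub_le_sup => //; exists N.
    have : majorant n <= sup (range majorant) by apply: ub_le_sup => //; exists n.
    rewrite ltr_pdivlMr//; have := nm_ge0 x.
    move: (nm x) (majorant n) (majorant N) (sup _) => a b c f a0 bf fc bc.
    nra.
  exists N => m n /Hn Hm /Hn; rewrite nmB => Hn'.
  rewrite -(subrKA (sqrt_iter N x)) (le_lt_trans (ler_nmD _ _))//; lra.
have T1 x : nm (T x) <= nm x.
  rewrite leNgt; apply/negP => h.
  have /cvg_nmP/(_ (nm (T x) - nm x))[|N HN] := TP x; first by rewrite subr_gt0.
  have := HN _ (leqnn N); have := iter1 N x.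
  have := ler_nmD (sqrt_iter N x) (T x - sqrt_iter N x).
  rewrite addrC subrK nmB; clear; lra.
(* The uniform bound [iter1] controls [sqrt_iter n (sqrt_iter n x - T x)], so squares pass to the
   strong limit. *)
have TT x : (fun n => sqrt_iter n (sqrt_iter n x)) @ \oo --> T (T x).
  apply/cvg_nmP => e e0; have e2 : 0 < e / 2 by rewrite divr_gt0.
  have /cvg_nmP/(_ _ e2)[N1 H1] := TP x.
  have /cvg_nmP/(_ _ e2)[N2 H2] := TP (T x).
  exists (maxn N1 N2) => n; rewrite geq_max => /andP[/H1 h1 /H2 h2].
  rewrite -(subrKA (sqrt_iter n (T x))) (le_lt_trans (ler_nmD _ _))//.
  rewrite -(linB (sqrt_iter_linear n)).
  have := iter1 n (sqrt_iter n x - T x); rewrite mul1r.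
  by move: h1 h2; clear; lra.
have TE x : T x = (2^-1)%:C%C *: (B x + T (T x)).
  apply: (@cvg_nm_unique _ _ (fun n => sqrt_iter n.+1 x)).
    by move: (TP x); rewrite -(cvg_shiftS (sqrt_iter ^~ x)).
  apply: (cvg_operator (T := fun y => (2^-1)%:C%C *: y)).
    exact/bounded_scale/bounded_id.
  by apply: cvgD => //; exact: cvg_cst.
exists T; split=> // [x|X Xb XB x].
  have h : B x = T x + T x - T (T x).
    rewrite -[T x + T x]mulr2n -scaler_nat {1}TE scalerA.
    have -> : 2%:R * (2^-1)%:C%C = 1 :> R[i].
      by rewrite -[2%:R](rmorph_nat (real_complex R)) -rmorphM/= divff.
    by rewrite scale1r addrK.
  by rewrite h (linB (operator_linear Tb)) !opprD !opprK !addrA.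
apply: (@cvg_nm_unique _ _ (fun n => sqrt_iter n (X x))); last exact: TP.
have := cvg_operator Xb (TP x); rewrite (_ : _ \o _ = fun n => sqrt_iter n (X x))//.
by apply/funext => n /=; rewrite (sqrt_iter_comm (operator_linear Xb)).
Qed.

End SquareRoot.

Section Schur.
Context {R : realType} {H : hilbertType R}.

Lemma closed_ker (T : H -> H) : bounded_operator T -> closed [set x | T x = 0].
Proof.
move=> /bounded_nmP[TL [M M0 TM]] x /closure_nmP clx.
apply: nm_eq0; apply/eqP; rewrite eq_le nm_ge0 andbT leNgt; apply/negP => Tx0.
have M1 : 0 < M + 1 by rewrite ltr_wpDl.
have [y /= Ty] := clx _ (divr_gt0 Tx0 M1).
rewrite ltr_pdivlMr// => h.
have := TM (x - y); rewrite linB// Ty subr0.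
have := nm_ge0 (x - y); move: h; clear; lra.
Qed.

(** The kernel of [T] is a closed subspace invariant under [F] and contains [x], so it is
    everything. *)
Lemma irreducible_ker (F : set (H -> H)) (T : H -> H) x :
  acts_irreducibly F -> (forall X, F X -> linear X) -> bounded_operator T ->
  (forall X, F X -> forall y, X (T y) = T (X y)) ->
  x <> 0 -> T x = 0 -> forall y, T y = 0.
Proof.
move=> irr FL Tb TF x0 Tx0; have TL := operator_linear Tb.
pose W := ClosedSubspace (closed_ker Tb) (lin0 TL : [set x | T x = 0] 0)
  (fun k y z (h : T y = 0) (h' : T z = 0) =>
     eq_trans (TL k y z) (etrans (congr2 (fun a b => k *: a + b) h h')
       (etrans (addr0 _) (scaler0 _ k)))).
have [|W0|WT] := irr W.
- by move=> X FX y /= Ty; rewrite -TF// Ty lin0//; exact: FL.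
- by have : subspace_set W x by []; rewrite W0.
- by move=> y; have : subspace_set W y by rewrite WT.
Qed.

(** Shift [Y] by a real scalar [t] so that [Z = Y - t] satisfies [<Z x, x> = 0] at some [x <> 0]. A
    square root [C] of [Z^2] equals [Z] or [-Z] by irreducibility, and [<C x, x> = 0] forces
    [C x = 0]. Thus [Z] kills [x], hence everything. *)
Lemma schur (F : set (H -> H)) (Y : H -> H) :
  acts_irreducibly F -> (forall X, F X -> bounded_operator X) ->
  bounded_operator Y ->
  (forall x y, rdot (Y x) y = rdot x (Y y)) ->
  (forall X, F X -> forall y, X (Y y) = Y (X y)) -> is_scalar Y.
Proof.
move=> irr Fb Yb Ysym YF.
have FL X : F X -> linear X by move=> /Fb[].
have [[x x0]|H0] := pselect (exists x : H, x <> 0); last first.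
  have H0' (x : H) : x = 0 by apply: contrapT => x0; apply: H0; exists x.
  by exists 0 => x; rewrite [LHS]H0' [RHS]H0'.
pose t := rdot (Y x) x / nm x ^+ 2; exists t%:C%C.
pose Z y := Y y + (- t)%:C%C *: y.
have Zb : bounded_operator Z by apply: bounded_add => //; exact/bounded_scale/bounded_id.
have Zsym y z : rdot (Z y) z = rdot y (Z z) by rewrite /Z !rdotE Ysym.
have ZF X : F X -> forall y, X (Z y) = Z (X y).
  by move=> FX y; rewrite /Z (linD (FL _ FX)) (linZ (FL _ FX)) YF.
have nx0 : nm x ^+ 2 != 0.
  by rewrite sqrf_eq0; apply/eqP => /nm_eq0.
have Zxx : rdot (Z x) x = 0.
  by rewrite /Z !rdotE -sqr_nm /t mulNr divfK// subrr.
suff Zx0 : Z x = 0.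
  move=> y; have := irreducible_ker irr FL Zb ZF x0 Zx0 y.
  by rewrite /Z rmorphN scaleNr => /eqP; rewrite subr_eq0 => /eqP.
clearbody Z.
have /bounded_nmP[ZL [M0 M00 ZM0]] := Zb.
pose M := M0 + 1; have M_gt0 : 0 < M by rewrite ltr_wpDl.
have ZM y : nm (Z y) <= M * nm y.
  by rewrite (le_trans (ZM0 _))// ler_wpM2r ?nm_ge0// lerDl.
pose B y := y + (- M ^- 2)%:C%C *: Z (Z y).
have Bb : bounded_operator B.
  apply: bounded_add; first exact: bounded_id.
  exact/bounded_scale/(bounded_comp Zb Zb).
(* In the expansion of [nm (B y) ^+ 2], the quartic term in [Z] is at most [M ^- 2 * nm (Z y) ^+ 2],
   half of what the cross term subtracts. *)
have B1 y : nm (B y) <= nm y.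
  rewrite -(@ler_pXn2r _ 2) ?nnegrE ?nm_ge0//.
  have : nm (Z (Z y)) ^+ 2 <= M ^+ 2 * nm (Z y) ^+ 2.
    by rewrite -exprMn ler_pXn2r ?nnegrE ?nm_ge0// mulr_ge0 ?nm_ge0// ltW.
  rewrite -ler_pdivrMl ?exprn_gt0// => h.
  rewrite sqr_nm /B !rdotE [rdot (Z (Z y)) y]Zsym -[rdot y (Z (Z y))]Zsym -!sqr_nm.
  have M2 : 0 < M ^- 2 by rewrite invr_gt0 exprn_gt0.
  have := ler_wpM2l (ltW M2) h; have := mulr_ge0 (ltW M2) (sqr_ge0 (nm (Z y))).
  by move: (M ^- 2) => w; clear; lra.
have [T [Tb T1 TT TC]] := contraction_sqrt (operator_linear Bb) B1.
have TL := operator_linear Tb.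
have commB X : linear X -> (forall y, X (Z y) = Z (X y)) ->
    forall y, X (B y) = B (X y).
  by move=> XL XZ y; rewrite /B (linD XL) (linZ XL) !XZ.
have ZT y : Z (T y) = T (Z y) by apply: TC => //; exact: commB.
(* Since [(1 - T)^2 = 1 - B = M^-2 Z^2], the factor [M] makes [C] a square root of [Z^2]. *)
pose C y := M%:C%C *: (y - T y).
have CZ y : C (Z y) = Z (C y) by rewrite /C (linZ ZL) (linB ZL) ZT.
have CC y : C (C y) = Z (Z y).
  rewrite /C (linZ TL) -scalerBr scalerA TT /B opprD addrA subrr add0r.
  rewrite rmorphN scaleNr opprK scalerA -!rmorphM /=.
  by rewrite -expr2 divff ?expf_neq0 ?gt_eqF// scale1r.
have Cb : bounded_operator C.
  apply: bounded_scale; rewrite (_ : (fun _ => _) = fun y => y + (-1) *: T y).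
    by apply: bounded_add; [exact: bounded_id|exact: bounded_scale].
  by apply/funext => y; rewrite scaleN1r.
have CF X : F X -> forall y, X (C y) = C (X y).
  move=> FX y; have XL := FL _ FX.
  rewrite /C (linZ XL) (linB XL) TC//; first exact: Fb.
  exact/commB/ZF.
(* If [<x - T x, x> = 0], then the squared norm of [x - T x] is [nm (T x) ^+ 2 - nm x ^+ 2], which
   is nonpositive as [T] is a contraction. *)
have Cx0 : rdot (C x) x = 0 -> C x = 0.
  rewrite /C rdotZl => /eqP; rewrite mulf_eq0 gt_eqF//= => /eqP Txx.
  rewrite (_ : x - T x = 0) ?scaler0//; apply/nm_eq0/eqP.
  rewrite -sqrf_eq0 eq_le sqr_ge0 andbT sqr_nm rdotDr Txx add0r rdotNr.
  move: Txx; rewrite !rdotDl !rdotNl -!sqr_nm (rdotC x (T x)).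
  have : nm (T x) ^+ 2 <= nm x ^+ 2 by rewrite ler_pXn2r ?nnegrE ?nm_ge0.
  by clear; lra.
clearbody C.
(* [(C - Z)(C + Z) = 0], so irreducibility gives [Z = C] or [Z = - C]. *)
have [e e0 ZC] : exists2 e : R, e != 0 & forall y, C y = e%:C%C *: Z y.
  have CL := operator_linear Cb.
  have [CZ0|/existsNP[y CZy]] := pselect (forall y, C y + Z y = 0).
    exists (-1) => [|y]; first by rewrite oppr_eq0 oner_eq0.
    by apply/eqP; rewrite rmorphN1 scaleN1r -addr_eq0 CZ0.
  have Db : bounded_operator (fun y => C y + (-1) *: Z y).
    by apply: bounded_add => //; exact: bounded_scale.
  exists 1 => [|z]; first exact: oner_neq0.
  apply/eqP; rewrite rmorph1 scale1r -subr_eq0 -scaleN1r; apply/eqP.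
  apply: (irreducible_ker irr FL Db _ CZy) => [X FX w /=|].
    by rewrite (linD (FL _ FX)) (linZ (FL _ FX)) ZF// CF.
  rewrite (linD CL) (linD ZL) CC CZ scaleN1r.
  by rewrite [X in _ - X]addrC subrr.
have : C x = 0 by apply: Cx0; rewrite ZC rdotZl Zxx mulr0.
rewrite ZC => /eqP; rewrite scaler_eq0 => /orP[/eqP ez|/eqP//].
by move: e0; rewrite (complexI ez) eqxx.
Qed.

End Schur.

(** * Positive functionals on a C*-algebra *)

Section PositiveForms.
Context {R : realType} {U : lmodType R[i]} (F : U -> U -> R[i]).
Hypotheses
  (FPl : forall k x y z, F (k *: x + y) z = k * F x z + F y z)
  (FPr : forall k x y z, F z (k *: x + y) = Num.conj k * F z x + F z y)
  (F_ge0 : forall x, 0 <= F x x).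

(** Diagonal values are real; expanding them at [x + y] and at ['i *: x + y] relates the imaginary
    and the real parts of the two mixed terms. *)
Lemma form_herm x y : F y x = Num.conj (F x y).
Proof.
have ImF z : Im (F z z) = 0 by apply: ger0_Im.
have := ImF ('i%C *: x + y); have := ImF (1 *: x + y).
rewrite !FPl !FPr rmorph1 !mul1r.
have := ImF x; have := ImF y.
case: (F x x) (F y y) (F x y) (F y x) => [a1 a2] [b1 b2] [c1 c2] [d1 d2] /= -> ->.
by move=> h1 h2; congr Complex; move: h1 h2; clear; lra.
Qed.

Lemma form_real_cs x y : Re (F x y) ^+ 2 <= Re (F x x) * Re (F y y).
Proof.
have quad (t : R) :
    0 <= t ^+ 2 * Re (F x x) + 2 * t * Re (F x y) + Re (F y y).
  have := Re_ge0 (F_ge0 (t%:C%C *: x + y)).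
  rewrite !FPl !FPr (form_herm x y).
  case: (F x x) (F y y) (F x y) => [a1 a2] [b1 b2] [c1 c2] /= h.
  by move: h; clear; lra.
have := Re_ge0 (F_ge0 x); have := Re_ge0 (F_ge0 y).
move: quad; move: (Re (F x x)) (Re (F x y)) (Re (F y y)) => a b c quad c0 a0.
have [a00|a00] := eqVneq a 0.
  have [->|b0] := eqVneq b 0; first by rewrite expr0n/= mulr_ge0.
  (* When [a = 0] the quadratic in [t] is affine, and this [t] gives it the value -1. *)
  have := quad (- (c + 1) / (2 * b)).
  rewrite a00 mulr0 add0r (_ : 2 * _ * b = - (c + 1)); last by field.
  by move=> h; lra.
have := quad (- b / a); have a1 : 0 < a by rewrite lt_neqAle eq_sym a00.
rewrite (_ : _ + _ + _ = (a * c - b ^+ 2) / a); last by field.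
by rewrite pmulr_lge0 ?invr_gt0// subr_ge0.
Qed.

(** Multiplying [x] by the conjugate of [p = F x y] turns the mixed term into the real number
    [|p|^2]; the real inequality then gives the claim times [|p|^2]. *)
Lemma form_cs x y : Re `|F x y| ^+ 2 <= Re (F x x) * Re (F y y).
Proof.
set p := F x y.
have [p0|p0] := eqVneq p 0.
  by rewrite p0 normr0 expr0n/= mulr_ge0// Re_ge0.
have pp : 0 < Re `|p| ^+ 2.
  rewrite exprn_gt0// lt_neqAle Re_ge0// andbT eq_sym.
  apply: contra_neq p0 => h; apply/eqP; rewrite -normr_eq0.
  by rewrite (ge0_ReE (normr_ge0 p)) h.
have := form_real_cs (Num.conj p *: x + 0) y.
have F0 z : F 0 z = 0.
  by apply/(addrI (F 0 z)); rewrite -{1}[F 0 z]mul1r -FPl addr0 scaler0 addr0.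
have F0' z : F z 0 = 0.
  by rewrite form_herm F0 rmorph0.
rewrite !FPl FPr !F0 !F0' !addr0 -/p conjCK.
have pE : Num.conj p * p = (Re `|p| ^+ 2)%:C%C.
  by rewrite mulrC -normCK {1}(ge0_ReE (normr_ge0 p)) rmorphXn.
rewrite mulrA pE ReZ /= => h.
by move: h; rewrite [X in X <= _]expr2 -mulrA ler_pM2l.
Qed.

End PositiveForms.

(** * Norm estimates for positive functionals *)

Section Functionals.
Context {R : realType} {A : cstarAlgType R}.
Implicit Types a b : A.

Definition cn a : R := Re (cnorm a).

Lemma star1 : star (1 : A) = 1.
Proof. by have := starM (star (1 : A)) 1; rewrite !(mulr1, starK). Qed.

Lemma cnorm0 : cnorm (0 : A) = 0.
Proof. by rewrite -(scale0r (0 : A)) cnormZ normr0 mul0r. Qed.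

Lemma cnormN a : cnorm (- a) = cnorm a.
Proof. by rewrite -scaleN1r cnormZ normrN1 mul1r. Qed.

Lemma cnorm_ge0 a : 0 <= cnorm a.
Proof.
have := cnormD_le a (- a); rewrite subrr cnorm0 cnormN -mulr2n.
by rewrite pmulrn_lge0.
Qed.

Lemma cnormE a : cnorm a = (cn a)%:C%C.
Proof. exact/ge0_ReE/cnorm_ge0. Qed.

Lemma cn_ge0 a : 0 <= cn a.
Proof. exact/Re_ge0/cnorm_ge0. Qed.

Lemma cn_starM a : cn (star a * a) = cn a ^+ 2.
Proof. by rewrite /cn cnorm_starM cnormE -rmorphXn. Qed.

Lemma cnM_le a b : cn (a * b) <= cn a * cn b.
Proof. by have := cnormM_le a b; rewrite !cnormE -rmorphM lecR. Qed.

(** The C*-identity gives [cn b ^+ 2 <= cn (star b) * cn b]; divide, and apply this to [star a] as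
    well. *)
Lemma cn_star a : cn (star a) = cn a.
Proof.
suff h b : cn b <= cn (star b).
  by apply/eqP; rewrite eq_le h -{2}(starK a) h.
have [->|b0] := eqVneq (cn b) 0; first exact: cn_ge0.
have b1 : 0 < cn b by rewrite lt_neqAle eq_sym b0 cn_ge0.
by rewrite -(ler_pM2r b1) -expr2 -cn_starM cnM_le.
Qed.

Section PositiveFunctional.
Variable phi : A -> R[i].
Hypotheses (phiL : scalar phi) (phi_ge0 : forall a, 0 <= phi (star a * a)).
Local Notation p a := (Re (phi (star a * a))).

Let F a b := phi (star b * a).
Let FPl k x y z : F (k *: x + y) z = k * F x z + F y z.
Proof. by rewrite /F mulrDr -scalerAr phiL. Qed.
Let FPr k x y z : F z (k *: x + y) = Num.conj k * F z x + F z y.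
Proof. by rewrite /F starD starZ mulrDl -scalerAl phiL. Qed.

Lemma functional_herm a : phi (star a) = Num.conj (phi a).
Proof.
by have := form_herm FPl FPr phi_ge0 a 1; rewrite /F mulr1 star1 mul1r.
Qed.

Lemma functional_cs a b :
  Re `|phi (star b * a)| ^+ 2 <= p a * p b.
Proof. exact: (form_cs FPl FPr phi_ge0). Qed.

Lemma functional_cs1 a : Re `|phi a| ^+ 2 <= Re (phi 1) * p a.
Proof. by have := functional_cs a 1; rewrite star1 mulr1 mul1r mulrC. Qed.

(* By Cauchy-Schwarz, if [c] bounds [phi (a^* a) / |a|^2], then so does
   [sqrt (phi 1 * c)]; hence the least bound is at most [phi 1]. *)
Lemma positive_functional_le C :
  (forall a, p a <= C * cn a ^+ 2) ->
  forall a, p a <= Re (phi 1) * cn a ^+ 2.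
Proof.
move=> pC.
pose S := [set c : R | 0 <= c /\ forall a, p a <= c * cn a ^+ 2].
have hS : has_inf S.
  split; last by exists 0 => c [].
  exists `|C|; split=> // a; rewrite (le_trans (pC a))// ler_wpM2r ?sqr_ge0//.
  exact: ler_norm.
have p1_ge0 : 0 <= Re (phi 1).
  by have := Re_ge0 (phi_ge0 1); rewrite star1 mulr1.
have S_sqrt c : S c -> S (Num.sqrt (Re (phi 1) * c)).
  move=> [c0 Sc]; split=> [|a]; first exact: sqrtr_ge0.
  have pa0 := Re_ge0 (phi_ge0 a).
  rewrite -(@ler_pXn2r _ 2) ?nnegrE ?mulr_ge0 ?sqrtr_ge0 ?cn_ge0//.
  rewrite exprMn sqr_sqrtr ?mulr_ge0//.
  (* Cauchy-Schwarz against 1 at [star a * a], followed by the bound [c] at that same element, whose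
     norm is [cn a ^+ 2]. *)
  have := functional_cs1 (star a * a).
  rewrite (ge0_ReE (phi_ge0 a)) ger0_norm ?ler0c//= => h.
  rewrite (le_trans h)// -mulrA ler_wpM2l// (le_trans (Sc _))//.
  by rewrite cn_starM.
pose c0 := inf S.
have c0_le c : S c -> c0 <= c by move=> Sc; apply: ge_inf; [case: hS|].
have c0_ge0 : 0 <= c0.
  by apply: lb_le_inf; [case: hS|move=> c []].
have c0S : S c0.
  split=> // a; rewrite leNgt; apply/negP => h.
  have [a0|a0] := eqVneq (cn a) 0.
    by have := lt_le_trans h (pC a); rewrite a0 expr0n/= !mulr0 ltxx.
  have a2 : 0 < cn a ^+ 2 by rewrite exprn_gt0// lt_neqAle eq_sym a0 cn_ge0.
  have : 0 < p a / cn a ^+ 2 - c0 by rewrite subr_gt0 ltr_pdivlMr.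
  move=> /inf_adherent/(_ hS)[c [_ Sc]].
  rewrite -/c0 addrC subrK ltNge ler_pdivrMr// => /negP; apply; exact: Sc.
have [_ Sc0] := c0S.
have c1 : c0 <= Re (phi 1).
  have := c0_le _ (S_sqrt _ c0S).
  rewrite -(@ler_pXn2r _ 2) ?nnegrE ?sqrtr_ge0// sqr_sqrtr ?mulr_ge0//.
  have [->//|n0] := eqVneq c0 0.
  by rewrite expr2 ler_pM2r// lt_neqAle eq_sym n0.
by move=> a; rewrite (le_trans (Sc0 a))// ler_wpM2r// sqr_ge0.
Qed.

End PositiveFunctional.

Lemma scalar_functional (phi : A -> R[i]) :
  scalar phi -> exists f : {scalar A}, f =1 phi.
Proof.
move=> phiL; pose mx := GRing.isLinear.Build R[i] A R[i] *%R phi phiL.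
by pose f : {scalar A} := HB.pack phi mx; exists f.
Qed.

(** Any crude bound [C] suffices: [positive_functional_le] improves it to [c], and Cauchy-Schwarz
    against 1 then gives [|phi a| <= c * cn a]. *)
Lemma state_of (phi : A -> R[i]) (c C : R) :
  scalar phi -> (forall a, 0 <= phi (star a * a)) -> phi 1 = c%:C%C -> 0 < c ->
  (forall a, Re (phi (star a * a)) <= C * cn a ^+ 2) ->
  exists2 f : {scalar A}, is_state f & forall a, f a = (c^-1)%:C%C * phi a.
Proof.
move=> phiL phi0 phi1 c0 phiC.
have [|f fE] := @scalar_functional (fun a => (c^-1)%:C%C * phi a).
  by move=> k a b; rewrite phiL mulrDr !mulrA [_ * k]mulrC.
exists f => //; split=> [a||a].
- by rewrite fE mulr_ge0// ler0c invr_ge0 ltW.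
- by rewrite fE phi1 -rmorphM /= mulVf ?gt_eqF.
- rewrite fE normrM ger0_norm ?ler0c ?invr_ge0 ?(ltW c0)//.
  rewrite (ge0_ReE (normr_ge0 _)) cnormE -rmorphM lecR.
  rewrite ler_pdivrMl// -(@ler_pXn2r _ 2) ?nnegrE ?mulr_ge0 ?cn_ge0 ?Re_ge0 ?(ltW c0)//.
  rewrite (le_trans (functional_cs1 phiL phi0 a))// phi1 /=.
  rewrite exprMn expr2 -mulrA ler_pM2l//.
  by have := positive_functional_le phiL phi0 phiC a; rewrite phi1.
Qed.

End Functionals.

(** * The cyclic representation of a state *)

Section GNS.
Context {R : realType} {A : cstarAlgType R} {omega : {scalar A} }.
Context {H : hilbertType R} {Omega : H} (pi : A -> H -> H).
Hypotheses (homega : is_state omega) (hpi : is_gns omega Omega pi).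

Lemma gns_bounded a : bounded_operator (pi a).
Proof. by case: hpi => -[]. Qed.

Let piL a : linear (pi a) := operator_linear (gns_bounded a).

Lemma gnsP k a b x : pi (k *: a + b) x = k *: pi a x + pi b x.
Proof. by case: hpi => -[]. Qed.

Lemma gns1 x : pi 1 x = x.
Proof. by case: hpi => -[_ _ -> _ _]. Qed.

Lemma gnsM a b x : pi (a * b) x = pi a (pi b x).
Proof. by case: hpi => -[_ _ _ -> _]. Qed.

Lemma gns_star a : pi (star a) = adj (pi a).
Proof. by case: hpi => -[]. Qed.

Lemma gns_linear x : linear (pi ^~ x).
Proof. by move=> k a b; exact: gnsP. Qed.

Lemma gnsE a : omega a = hdot (pi a Omega) Omega.
Proof. by case: hpi. Qed.

Lemma gns_adj a x y : hdot (pi (star a) x) y = hdot x (pi a y).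
Proof.
rewrite adj_hdot; last exact: gns_bounded.
by rewrite gns_star adjK//; exact: gns_bounded.
Qed.

Lemma gns_hdot a b : hdot (pi a Omega) (pi b Omega) = omega (star b * a).
Proof. by rewrite gnsE gnsM gns_adj. Qed.

Lemma gns_sqr_nm a : nm (pi a Omega) ^+ 2 = Re (omega (star a * a)).
Proof. by rewrite sqr_nm /rdot gns_hdot. Qed.

Lemma gns_dense x (e : R) : 0 < e -> exists a, nm (x - pi a Omega) < e.
Proof.
case: hpi => _ dense _ e0; have : closure [set pi a Omega | a in setT] x.
  by rewrite dense.
by move=> /closure_nmP/(_ _ e0)[_ [a _ <-] ?]; exists a.
Qed.

Lemma gns_Omega : nm Omega = 1.
Proof.
have [_ o1 _] := homega; apply/eqP; rewrite -(@eqrXn2 _ 2) ?nm_ge0//.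
by rewrite sqr_nm /rdot -{1}(gns1 Omega) -gnsE o1 expr1n.
Qed.

Lemma gns_ext (T T' : H -> H) : bounded_operator T -> bounded_operator T' ->
  (forall a, T (pi a Omega) = T' (pi a Omega)) -> T =1 T'.
Proof.
move=> Tb Tb' TT' x.
have Db : bounded_operator (fun y => T y + (-1) *: T' y).
  by apply: bounded_add => //; exact: bounded_scale.
suff : [set y | T y + (-1) *: T' y = 0] x.
  by rewrite /= scaleN1r => /eqP; rewrite subr_eq0 => /eqP.
apply: (closed_ker Db); apply/closure_nmP => e e0.
have [a xa] := gns_dense x e0; exists (pi a Omega) => //=.
by rewrite TT' scaleN1r subrr.
Qed.

(** Test [z] against vectors [pi a Omega] that approximate [z] itself. *)
Lemma gns_nm_le (C : R) z : 0 <= C ->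
  (forall a, rdot (pi a Omega) z <= C * nm (pi a Omega)) -> nm z <= C.
Proof.
move=> C0 zC; have [->//|z0] := eqVneq (nm z) 0.
have z1 : 0 < nm z by rewrite lt_neqAle eq_sym z0 nm_ge0.
rewrite -(ler_pM2r z1) -expr2; apply/ler_addgt0Pr => e e0.
have Cz : 0 < C + nm z by rewrite ltr_wpDl.
have [a] := gns_dense z (divr_gt0 e0 Cz); rewrite ltr_pdivlMr// => za.
have := zC a; have := rdot_le_nm (z - pi a Omega) z.
rewrite rdotDl rdotNl -sqr_nm => h1 h2.
have := ler_nmD z (pi a Omega - z); rewrite addrC subrK (nmB _ z).
move=> /(ler_wpM2l C0); move: za h1 h2; clear; lra.
Qed.

Lemma gns_hdot_ext z z' :
  (forall a, hdot (pi a Omega) z = hdot (pi a Omega) z') -> z = z'.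
Proof.
move=> zz'; apply/eqP; rewrite -subr_eq0; apply/eqP/nm_eq0/eqP.
rewrite eq_le nm_ge0 andbT; apply: gns_nm_le => // a.
by rewrite mul0r rdotDr rdotNr /rdot zz' subrr.
Qed.

Lemma gns_omega_le a : Re (omega (star a * a)) <= cn a ^+ 2.
Proof.
have [pos _ bnd] := homega; have := bnd (star a * a).
by rewrite (ge0_ReE (pos a)) ger0_norm ?ler0c ?Re_ge0// cnormE lecR cn_starM.
Qed.

(** For [y = pi b Omega], the positive functional [c |-> <pi c y, y>] satisfies a crude bound with
    constant [cn b ^+ 2], which [positive_functional_le] lowers to its value [nm y ^+ 2] at 1.
    Density of such [y] extends the estimate. *)
Lemma gns_le a x : nm (pi a x) <= cn a * nm x.
Proof.
have cyclic b : nm (pi a (pi b Omega)) <= cn a * nm (pi b Omega).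
  set y := pi b Omega; pose phi c := hdot (pi c y) y.
  have phiE c : phi (star c * c) = (nm (pi c y) ^+ 2)%:C%C.
    by rewrite /phi gnsM gns_adj hdotxx.
  have phiL : scalar phi by move=> k c c'; rewrite /phi gnsP hdotP.
  have phi0 c : 0 <= phi (star c * c) by rewrite phiE ler0c sqr_ge0.
  have := positive_functional_le phiL phi0 (C := cn b ^+ 2) _ a.
  have phi_one : phi 1 = (nm y ^+ 2)%:C%C by rewrite /phi gns1 hdotxx.
  rewrite phiE phi_one /= => h.
  rewrite -(@ler_pXn2r _ 2) ?nnegrE ?mulr_ge0 ?nm_ge0 ?cn_ge0//.
  rewrite exprMn mulrC; apply: h => c.
  rewrite phiE /= -gnsM gns_sqr_nm (le_trans (gns_omega_le _))//.
  by rewrite mulrC -exprMn ler_pXn2r ?nnegrE ?mulr_ge0 ?cn_ge0// cnM_le.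
have /bounded_nmP[_ [M M0 piM]] := gns_bounded a.
apply/ler_addgt0Pr => e e0.
have M1 : 0 < cn a + M + 1 by rewrite ltr_wpDl// addr_ge0 ?cn_ge0.
have [b] := gns_dense x (divr_gt0 e0 M1); set y := pi b Omega => xy.
have := ler_nmD (pi a y) (pi a x - pi a y); rewrite addrC subrK -(linB (piL a)).
move=> /le_trans; apply.
have := ler_nmD x (y - x); rewrite addrC subrK (nmB y).
move=> /(ler_wpM2l (cn_ge0 a)) h.
have := piM (x - y); have := cyclic b; rewrite -/y.
move: xy; rewrite ltr_pdivlMr//; have := nm_ge0 (x - y).
by move: h; clear; lra.
Qed.

(** The elements [a] for which [X] commutes with both [pi a] and [pi (star a)] form a closed
    star-subalgebra containing the generators. Both conditions are imposed because [X] need not be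
    self-adjoint. *)
Lemma gns_generated d (s : 'I_d -> A) (X : H -> H) :
  generates s -> bounded_operator X ->
  (forall i x, X (pi (s i) x) = pi (s i) (X x)) ->
  (forall i x, X (pi (star (s i)) x) = pi (star (s i)) (X x)) ->
  forall a x, X (pi a x) = pi a (X x).
Proof.
move=> gen Xb Xs Xs'; have XL := operator_linear Xb.
have /bounded_nmP[_ [M M0 XM]] := Xb.
pose C a := forall x, X (pi a x) = pi a (X x).
pose B : set A := [set a | C a /\ C (star a)].
suff BT : B = setT by move=> a; have [] : B a by rewrite BT.
have C_lin k a b : C a -> C b -> C (k *: a + b).
  by move=> Ca Cb x; rewrite !gnsP XL Ca Cb.
have C_mul a b : C a -> C b -> C (a * b).
  by move=> Ca Cb x; rewrite !gnsM Ca Cb.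
have C_one : C 1 by move=> x; rewrite !gns1.
have C_closed a : (forall e : R, 0 < e -> exists2 b, C b & cn (a - b) < e) -> C a.
  move=> Ca x; apply/eqP; rewrite -subr_eq0; apply/eqP/nm_eq0/eqP.
  rewrite eq_le nm_ge0 andbT; apply/ler_addgt0Pr => e e0; rewrite add0r.
  have K1 : 0 < 2 * M * nm x + 1 by rewrite ltr_wpDl// !mulr_ge0// nm_ge0.
  have [b Cb] := Ca _ (divr_gt0 e0 K1).
  rewrite ltr_pdivlMr// => ab.
  (* As [X] commutes with [pi b], only [a - b] contributes, at most [2 * M * nm x * cn (a - b)]. *)
  have -> : X (pi a x) - pi a (X x) = X (pi (a - b) x) - pi (a - b) (X x).
    rewrite !(linB (gns_linear _)) (linB XL) Cb.
    by rewrite opprB addrA subrK.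
  rewrite (le_trans (ler_nmD _ _))// nmN.
  have := XM (pi (a - b) x); have := gns_le (a - b) (X x).
  have := ler_wpM2l M0 (gns_le (a - b) x).
  have := ler_wpM2l (cn_ge0 (a - b)) (XM x).
  move: ab; have := cn_ge0 (a - b); clear; lra.
apply: gen => [|i]; last by split.
split.
- move=> a Ba; split.
    apply: C_closed => e e0; have [|b [Cb _]] := Ba e%:C%C; first by rewrite ltcR.
    by rewrite cnormE ltcR; exists b.
  apply: C_closed => e e0; have [|b [_ Cb]] := Ba e%:C%C; first by rewrite ltcR.
  rewrite cnormE ltcR -cn_star starD => ab.
  exists (star b) => //; move: ab.
  by rewrite -scaleN1r starZ rmorphN1 scaleN1r.
- by split; rewrite ?star1.
- move=> k a b [Ca Ca'] [Cb Cb']; split; first exact: C_lin.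
  by rewrite starD starZ; exact: C_lin.
- move=> a b [Ca Ca'] [Cb Cb']; split; first exact: C_mul.
  by rewrite starM; exact: C_mul.
- by move=> a [Ca Ca']; split; rewrite ?starK.
Qed.

(** A cyclic vector separates the commutant. *)
Lemma gns_commutant_scalar (X : H -> H) c : bounded_operator X ->
  (forall a x, X (pi a x) = pi a (X x)) -> X Omega = c *: Omega ->
  forall x, X x = c *: x.
Proof.
move=> Xb XC Xc; apply: gns_ext => // [|a].
  exact/bounded_scale/bounded_id.
by rewrite XC Xc (linZ (piL a)).
Qed.

(** Positivity holds because the functional takes the value [<Q (pi a Omega), pi a Omega>] at
    [star a * a], up to normalisation. *)
Lemma commutant_state (Q : H -> H) : bounded_operator Q ->
  (forall a x, Q (pi a x) = pi a (Q x)) ->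
  (forall x y, rdot (Q x) y = rdot x (Q y)) ->
  (forall x, 0 <= rdot (Q x) x) -> 0 < rdot (Q Omega) Omega ->
  exists2 f : {scalar A}, is_state f & forall a,
    f a = ((rdot (Q Omega) Omega)^-1)%:C%C * hdot (pi a (Q Omega)) Omega.
Proof.
move=> Qb QC Qsym Q0 c0; have /bounded_nmP[QL [M M0 QM]] := Qb.
have Qadj : adj Q = Q by apply/funext => y; exact: adj_eq.
have QE x : hdot (Q x) x = (rdot (Q x) x)%:C%C.
  have : hdot (Q x) x = Num.conj (hdot (Q x) x).
    by rewrite -hdotC adj_hdot// Qadj.
  rewrite /rdot; case: (hdot (Q x) x) => a b [] h.
  by congr Complex; lra.
pose phi a := hdot (pi a (Q Omega)) Omega.
have phiE a : phi (star a * a) = (rdot (Q (pi a Omega)) (pi a Omega))%:C%C.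
  by rewrite /phi gnsM gns_adj -QC QE.
apply: (@state_of _ _ phi _ M) => //.
- by move=> k a b; rewrite /phi gnsP hdotP.
- by move=> a; rewrite phiE ler0c.
- by rewrite /phi gns1 QE.
- move=> a; rewrite phiE /= (le_trans (rdot_le_nm _ _))//.
  rewrite (le_trans (ler_wpM2r (nm_ge0 _) (QM _)))// -mulrA ler_wpM2l//.
  by rewrite -expr2 gns_sqr_nm gns_omega_le.
Qed.

(** For self-adjoint [T] in the commutant, [1/2 + m T] and [1/2 - m T] are positive for small [m]
    and sum to 1, so they write [omega] as a convex combination of two states. Purity makes [T]
    scalar; a general [X] is handled through its real and imaginary parts. *)
Lemma pure_commutant (X : H -> H) : is_pure omega -> bounded_operator X ->
  (forall a x, X (pi a x) = pi a (X x)) -> is_scalar X.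
Proof.
move=> [_ pure]; have selfadj (T : H -> H) : bounded_operator T ->
    (forall a x, T (pi a x) = pi a (T x)) ->
    (forall x y, rdot (T x) y = rdot x (T y)) -> is_scalar T.
  move=> Tb TC Tsym; have /bounded_nmP[TL [M0 M00 TM0]] := Tb.
  pose M := M0 + 1; have M_gt0 : 0 < M by rewrite ltr_wpDl.
  have TM x : `|rdot (T x) x| <= M * nm x ^+ 2.
    rewrite (le_trans (normr_rdot_le _ _))// expr2 mulrA ler_wpM2r ?nm_ge0//.
    by rewrite (le_trans (TM0 _))// ler_wpM2r ?nm_ge0// lerDl.
  (* A combination with spectrum in [1/4, 3/4]. *)
  pose m := (4 * M)^-1.
  have m0 : 0 < m by rewrite invr_gt0 mulr_gt0.
  pose Q e x := (2^-1)%:C%C *: x + (e * m)%:C%C *: T x.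
  have Qb e : bounded_operator (Q e).
    apply: bounded_add; apply: bounded_scale => //; exact: bounded_id.
  have QC e a x : Q e (pi a x) = pi a (Q e x).
    by rewrite /Q (linD (piL a)) !(linZ (piL a)) TC.
  have Qsym e x y : rdot (Q e x) y = rdot x (Q e y).
    by rewrite /Q !rdotE Tsym.
  have Q_ge (e : R) x : `|e| = 1 -> 4^-1 * nm x ^+ 2 <= rdot (Q e x) x.
    move=> e1; rewrite /Q !rdotE -sqr_nm -mulrA.
    have : `|e * (m * rdot (T x) x)| <= 4^-1 * nm x ^+ 2.
      rewrite normrM e1 mul1r normrM gtr0_norm// /m invfM -!mulrA.
      by rewrite ler_pM2l ?invr_gt0// ler_pdivrMl.
    rewrite ler_norml => /andP[h _]; move: h; clear; lra.
  have Q_ge0 e x : `|e| = 1 -> 0 <= rdot (Q e x) x.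
    by move=> /Q_ge => /(_ x); apply: le_trans; rewrite mulr_ge0 ?sqr_ge0.
  have Q_gt0 e : `|e| = 1 -> 0 < rdot (Q e Omega) Omega.
    move=> /Q_ge => /(_ Omega); apply: lt_le_trans.
    by rewrite gns_Omega expr1n mulr1 invr_gt0.
  have e1 : `|1| = 1 :> R by rewrite normr1.
  have eN1 : `|-1| = 1 :> R by rewrite normrN1.
  set c := rdot (Q 1 Omega) Omega.
  have cN : rdot (Q (-1) Omega) Omega = 1 - c.
    by rewrite /c /Q !rdotE -sqr_nm gns_Omega expr1n; lra.
  have [f fS fE] := commutant_state (Qb 1) (QC 1) (Qsym 1) (Q_ge0 _ ^~ e1) (Q_gt0 _ e1).
  have [g gS gE] := commutant_state (Qb (-1)) (QC (-1)) (Qsym (-1)) (Q_ge0 _ ^~ eN1) (Q_gt0 _ eN1).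
  have c0 : 0 < c by exact: Q_gt0.
  have c1 : 0 < 1 - c by rewrite -cN; exact: Q_gt0.
  have [||fo _] := pure f g c fS gS.
  - by rewrite c0 -subr_gt0.
  - move=> a; rewrite fE gE cN -/c !mulrA -!rmorphM /= !divff ?gt_eqF//.
    rewrite rmorph1 !mul1r -hdotDl -(linD (piL a)) gnsE; congr (hdot (pi a _) _).
    rewrite /Q addrACA mul1r mulN1r rmorphN scaleNr subrr addr0 -scalerDl -rmorphD /=.
    by rewrite [X in X%:C%C](_ : _ = 1) ?scale1r//; field.
  (* The equality [f = omega] at [star a] compares the inner products of both sides with the dense
     vectors [pi a Omega]. *)
  have QO : Q 1 Omega = c%:C%C *: Omega.
    apply: gns_hdot_ext => a.
    have h : hdot (Q 1 Omega) (pi a Omega) = c%:C%C * hdot Omega (pi a Omega).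
      have := fo (star a); rewrite fE -/c gnsE !gns_adj => <-.
      by rewrite mulrA -rmorphM /= divff ?gt_eqF// mul1r.
    by rewrite hdotZr hdotC h rmorphM /= -hdotC.
  have QS := gns_commutant_scalar (Qb 1) (QC 1) QO.
  exists (m^-1 * (c - 2^-1))%:C%C => x.
  have : (m)%:C%C *: T x = (c - 2^-1)%:C%C *: x.
    have := QS x; rewrite /Q mul1r rmorphB scalerBl => <-.
    by rewrite addrC addKr.
  move=> /(congr1 (fun y => (m^-1)%:C%C *: y)).
  by rewrite !scalerA -!rmorphM /= mulVf ?gt_eqF// scale1r.
move=> Xb XC; have Xb' := adj_bounded Xb.
have XC' a x : adj X (pi a x) = pi a (adj X x).
  have piE u v : rdot (pi (star a) u) v = rdot u (pi a v).
    by rewrite /rdot gns_adj.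
  apply: rdot_ext => y; rewrite -(adj_rdot y _ Xb) -[in RHS]piE.
  by rewrite -(adj_rdot (pi (star a) y) _ Xb) XC piE.
have [||x y|c1 H1] := selfadj (fun x => X x + adj X x).
- exact: bounded_add.
- by move=> a x; rewrite XC XC' (linD (piL a)).
- by rewrite rdotDl rdotDr adj_rdot// adj_rdotV// addrC.
(* The factor ['i] makes the skew part [X - adj X] self-adjoint, since it is skew for [rdot]. *)
have [||x y|c2 H2] := selfadj (fun x => 'i%C *: (X x + (-1) *: adj X x)).
- by apply/bounded_scale/bounded_add => //; exact: bounded_scale.
- by move=> a x; rewrite XC XC' (linZ (piL a)) (linD (piL a)) (linZ (piL a)).
- have XL := operator_linear Xb; have XL' := operator_linear Xb'.
  rewrite rdot_i !scaleN1r rdotDl rdotNl adj_rdot// adj_rdotV//.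
  by rewrite (linZ XL') (linZ XL) scalerBr rdotDr rdotNr opprB.
exists ((2^-1)%:C%C * (c1 - 'i%C * c2)) => x.
have ii (y : H) : 'i%C *: ('i%C *: y) = - y by rewrite scalerA -expr2 sqr_i scaleN1r.
have h2 : X x - adj X x = - ('i%C * c2) *: x.
  by rewrite scaleNr -scalerA -H2 scaleN1r (ii (X x - adj X x)) opprK.
have -> : X x = (2^-1)%:C%C *: ((X x + adj X x) + (X x - adj X x)).
  rewrite addrACA subrr addr0 scalerDr -scalerDl -rmorphD /=.
  by rewrite (_ : 2^-1 + 2^-1 = 1) ?scale1r//; field.
by rewrite -scalerA scalerBl h2 scaleNr -H1.
Qed.

End GNS.

(** * Fixed points of the Cuntz endomorphism *)

Section DominatedFunctional.
Context {R : realType} {A : cstarAlgType R} {omega : {scalar A} }.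
Context {H : hilbertType R} {Omega : H} (pi : A -> H -> H).
Hypotheses (homega : is_state omega) (hpi : is_gns omega Omega pi).

(** Riesz is applied twice: [z b] represents [a |-> f (star b * a)], and then [T x] represents
    [b |-> <z b, x>]. This defines [T] on all of [H] at once, with no extension from the dense
    subspace; [z b] plays the part of the adjoint of [T] at [pi b Omega]. *)
Lemma dominated_operator (f : {scalar A}) (K : R) : is_state f -> 0 <= K ->
  (forall a, Re (f (star a * a)) <= K * nm (pi a Omega) ^+ 2) ->
  exists T : H -> H, [/\ bounded_operator T,
    forall x y, rdot (T x) y = rdot x (T y),
    forall a x, T (pi a x) = pi a (T x)
    & forall a, f a = hdot (T (pi a Omega)) Omega].
Proof.
move=> [f_ge0 _ _] K0 fK; have fL : scalar f by move=> k a b; exact: linearP.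
pose n a := nm (pi a Omega).
have fle a b : Re (f (star b * a)) <= K * n b * n a.
  have := functional_cs fL f_ge0 a b => h.
  have h1 : Re (f (star b * a)) <= Re `|f (star b * a)|.
    have := normc_ge_Re (f (star b * a)); rewrite lecE => /andP[_ /=].
    by apply: le_trans; exact: ler_norm.
  rewrite (le_trans h1)// -(@ler_pXn2r _ 2) ?nnegrE ?mulr_ge0 ?nm_ge0 ?Re_ge0//.
  rewrite (le_trans h)// (_ : (_ * _) ^+ 2 = (K * n a ^+ 2) * (K * n b ^+ 2)).
    by rewrite ler_pM ?Re_ge0.
  by ring.
have gL x : linear (pi ^~ x) by exact: gns_linear hpi x.
have /choice[z zP] : forall b, exists z : H, forall a,
    f (star b * a) = hdot (pi a Omega) z.
  move=> b; apply: (@riesz _ _ A (pi ^~ Omega) _ (K * n b)) => //.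
  by move=> k a a'; rewrite mulrDr -scalerAr fL.
have zn b : nm (z b) <= K * n b.
  apply: (gns_nm_le hpi); first by rewrite mulr_ge0 ?nm_ge0.
  by move=> a; rewrite /rdot -zP.
have zL : linear z.
  move=> k a b; apply: (gns_hdot_ext hpi) => c.
  rewrite hdotDr hdotZr -!zP starD starZ mulrDl -scalerAl.
  by rewrite fL.
have /choice[T TP] : forall x, exists w : H, forall b,
    hdot (z b) x = hdot (pi b Omega) w.
  move=> x; apply: (@riesz _ _ A (pi ^~ Omega) _ (K * nm x)) => //.
    by move=> k a a'; rewrite zL hdotP.
  move=> a; rewrite (le_trans (rdot_le_nm (z a) x))//.
  by rewrite -mulrA [nm x * _]mulrC mulrA ler_wpM2r ?nm_ge0.
have Tb : bounded_operator T.
  apply/bounded_nmP; split=> [k x y|].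
    apply: (gns_hdot_ext hpi) => b.
    by rewrite hdotDr hdotZr -!TP hdotDr hdotZr.
  exists K => // x; apply: (gns_nm_le hpi); first by rewrite mulr_ge0 ?nm_ge0.
  move=> b; rewrite /rdot -TP (le_trans (rdot_le_nm _ _))//.
  by rewrite mulrAC ler_wpM2r ?nm_ge0.
have Tf a b : hdot (T (pi a Omega)) (pi b Omega) = f (star b * a).
  by rewrite hdotC -TP -hdotC -zP.
have pib := gns_bounded hpi.
exists T; split=> // [x y|a|a].
- suff -> : T y = adj T y by rewrite adj_rdot.
  move: y; apply: (gns_ext hpi) => //; first exact: adj_bounded.
  move=> a; apply: (gns_hdot_ext hpi) => b; rewrite -adj_hdot// hdotC !Tf.
  by rewrite -(functional_herm fL f_ge0) starM starK.
- apply: (gns_ext hpi (bounded_comp Tb (pib a)) (bounded_comp (pib a) Tb)) => b /=.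
  apply: (gns_hdot_ext hpi) => c; rewrite [LHS]hdotC [RHS]hdotC; congr Num.conj.
  rewrite -(gnsM hpi) Tf -[in RHS](starK a) (gns_adj hpi) -(gnsM hpi) Tf.
  by rewrite starM starK mulrA.
- by have := Tf a 1; rewrite (gns1 hpi) star1 mul1r.
Qed.

End DominatedFunctional.

(** * The endomorphism of a Cuntz family and its fixed points *)

Section CuntzFamily.
Context {R : realType} {H : hilbertType R} {d : nat} (S : 'I_d -> H -> H).
Hypotheses (Sb : forall i, bounded_operator (S i))
  (SS : forall i j x, adj (S i) (S j x) = (i == j)%:R *: x)
  (Ssum : forall x, \sum_(i < d) S i (adj (S i) x) = x).
Local Notation sigma := (cp_map S).

Let SL i : linear (S i) := operator_linear (Sb i).
Let Sb' i : bounded_operator (adj (S i)) := adj_bounded (Sb i).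
Let SL' i : linear (adj (S i)) := operator_linear (Sb' i).

Lemma adj_cuntz_sum i (u : 'I_d -> H) : adj (S i) (\sum_(j < d) S j (u j)) = u i.
Proof.
rewrite (lin_sum (SL' i)) (bigD1 i)//= SS eqxx scale1r big1 ?addr0// => j ji.
by rewrite SS eq_sym (negbTE ji) scale0r.
Qed.

Lemma cp_bounded X : bounded_operator X -> bounded_operator (sigma X).
Proof.
move=> Xb; apply: bounded_sum => i.
exact: (bounded_comp (Sb i) (bounded_comp Xb (Sb' i))).
Qed.

Lemma nm_cuntz_sum (u : 'I_d -> H) :
  nm (\sum_(i < d) S i (u i)) ^+ 2 = \sum_(i < d) nm (u i) ^+ 2.
Proof.
rewrite sqr_nm rdot_suml; apply: eq_bigr => i _.
by rewrite adj_rdot// adj_cuntz_sum sqr_nm.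
Qed.

(** Pythagoras: the ranges of the isometries [S i] are orthogonal and sum to [H]. *)
Lemma cp_le X M : 0 <= M -> (forall x, nm (X x) <= M * nm x) ->
  forall x, nm (sigma X x) <= M * nm x.
Proof.
move=> M0 XM x; rewrite -(@ler_pXn2r _ 2) ?nnegrE ?mulr_ge0 ?nm_ge0//.
rewrite exprMn -{2}(Ssum x) !nm_cuntz_sum mulr_sumr; apply: ler_sum => i _.
by rewrite -exprMn ler_pXn2r ?nnegrE ?mulr_ge0 ?nm_ge0.
Qed.

Lemma cp_comp X Y : sigma X \o sigma Y = sigma (X \o Y).
Proof.
by apply/funext => x; apply: eq_bigr => i _ /=; rewrite adj_cuntz_sum.
Qed.

Lemma cp_sym X : (forall x y, rdot (X x) y = rdot x (X y)) ->
  forall x y, rdot (sigma X x) y = rdot x (sigma X y).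
Proof.
move=> Xsym x y; rewrite rdot_suml rdot_sumr; apply: eq_bigr => i _.
by rewrite adj_rdot// Xsym adj_rdotV.
Qed.

(** The orthogonality relations collapse [sigma X] after [S i] to [S i X], and [adj (S i)] after
    [sigma X] to [X (adj (S i))]. *)
Lemma fixed_commutes X : linear X -> sigma X = X ->
  forall i x, X (S i x) = S i (X x) /\ X (adj (S i) x) = adj (S i) (X x).
Proof.
move=> XL fX i x; split; last by rewrite -[in RHS]fX /cp_map adj_cuntz_sum.
rewrite -[in LHS]fX /cp_map (bigD1 i)//= SS eqxx scale1r big1 ?addr0// => j ji.
by rewrite SS (negbTE ji) scale0r (lin0 XL) (lin0 (SL j)).
Qed.

Lemma commutes_fixed X : (forall i x, X (adj (S i) x) = adj (S i) (X x)) ->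
  sigma X = X.
Proof.
move=> XS; apply/funext => x; rewrite /cp_map.
by under eq_bigr do rewrite XS; rewrite Ssum.
Qed.

Lemma iter_cp_bounded n X : bounded_operator X -> bounded_operator (iter n sigma X).
Proof. by move=> Xb; elim: n => //= n; exact: cp_bounded. Qed.

Lemma iter_cp_le n X M : 0 <= M -> (forall x, nm (X x) <= M * nm x) ->
  forall x, nm (iter n sigma X x) <= M * nm x.
Proof. by move=> M0 XM; elim: n => //= n; exact: cp_le. Qed.

Lemma iter_cp_comp n X Y :
  iter n sigma X \o iter n sigma Y = iter n sigma (X \o Y).
Proof. by elim: n => //= n <-; rewrite cp_comp. Qed.

Lemma iter_cp_sym n X : (forall x y, rdot (X x) y = rdot x (X y)) ->
  forall x y, rdot (iter n sigma X x) y = rdot x (iter n sigma X y).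
Proof. by move=> Xsym; elim: n => //= n; exact: cp_sym. Qed.

Lemma iter_cp_limit_fixed X T : (forall x, (fun n => iter n sigma X x) @ \oo --> T x) ->
  sigma T = T.
Proof.
move=> XT; apply/funext => x.
apply: (@cvg_nm_unique _ _ (fun n => iter n.+1 sigma X x)).
  apply: cvg_sum_nm => i /=.
  exact: (cvg_operator (Sb i) (XT (adj (S i) x))).
by move: (XT x); rewrite -(cvg_shiftS (fun n => iter n sigma X x)).
Qed.

(** * Iterates of the projection onto a subspace invariant under the adjoints *)

Variable K : closed_subspace H.
Hypothesis KS : forall i x, subspace_set K x -> subspace_set K (adj (S i) x).
Local Notation P := (orthoproj K).
Local Notation E n := (iter n sigma P).

Let PP : P \o P = P.
Proof. by apply/funext => x /=; rewrite orthoproj_id//; exact: orthoproj_in. Qed.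

(** This is [P <= sigma P]: on [K] the inner projection acts trivially after [adj (S i)]. *)
Lemma cp_proj_absorbr : sigma P \o P = P.
Proof.
apply/funext => x /=; rewrite /cp_map -[RHS]Ssum; apply: eq_bigr => i _.
by rewrite orthoproj_id//; apply: KS; exact: orthoproj_in.
Qed.

Lemma cp_proj_absorbl : P \o sigma P = P.
Proof.
apply/funext => x; apply: rdot_ext => y /=.
rewrite -orthoproj_sym -(cp_sym (@orthoproj_sym _ _ K)).
by rewrite -[sigma P (P y)]/((sigma P \o P) y) cp_proj_absorbr orthoproj_sym.
Qed.

Let projP x : P (P x) = P x.
Proof. by rewrite -[P (P x)]/((P \o P) x) PP. Qed.

Let cp_projr x : sigma P (P x) = P x.
Proof. by rewrite -[LHS]/((sigma P \o P) x) cp_proj_absorbr. Qed.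

Let cp_projl x : P (sigma P x) = P x.
Proof. by rewrite -[LHS]/((P \o sigma P) x) cp_proj_absorbl. Qed.

Let cpE X Y x : sigma X (sigma Y x) = sigma (X \o Y) x.
Proof. by rewrite -cp_comp. Qed.

Let iter_cpE n X Y x : iter n sigma X (iter n sigma Y x) = iter n sigma (X \o Y) x.
Proof. by rewrite -iter_cp_comp. Qed.

(** Insert [sigma P] next to each outer [P]; multiplicativity of [sigma] moves the compression
    inside, where the induction hypothesis applies. *)
Lemma proj_compress j X : P \o sigma X \o P = X -> P \o iter j sigma X \o P = X.
Proof.
move=> PXP; elim: j => [|j IH].
  by apply/funext => x /=; rewrite -PXP /= !projP.
rewrite -[RHS]PXP -[in RHS]IH; apply/funext => x /=.
by rewrite -[in LHS]cp_projl -[in LHS](cp_projr x) !cpE.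
Qed.

Lemma proj_iter_absorbl j : P \o E j = P.
Proof.
elim: j => [|j IH]; first exact: PP.
apply/funext => x /=; rewrite -cp_projl cpE IH.
exact: cp_projl.
Qed.

Lemma proj_iter_absorbr j : E j \o P = P.
Proof.
elim: j => [|j IH]; first exact: PP.
apply/funext => x /=; rewrite -[P x in LHS]cp_projr cpE IH.
exact: cp_projr.
Qed.

Lemma iter_proj_absorb k m x : (k <= m)%N ->
  E m (E k x) = E k x /\ E k (E m x) = E k x.
Proof.
move=> /subnKC <-; rewrite !iterD !iter_cpE.
by rewrite proj_iter_absorbr proj_iter_absorbl.
Qed.

Lemma iter_compress X k m x : P \o sigma X \o P = X -> (k <= m)%N ->
  E k (iter m sigma X (E k x)) = iter k sigma X x.
Proof.
move=> PXP /subnKC <-; rewrite iterD !iter_cpE.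
by rewrite proj_compress.
Qed.

(** The increment [v m - v k] is orthogonal to [v k], so its squared norm is the difference of the
    squared norms, which are bounded and increasing from [n0] on. *)
Lemma iter_proj_martingale (v : nat -> H) (C : R) n0 :
  (forall k m, (n0 <= k)%N -> (k <= m)%N -> E k (v m) = v k) ->
  (forall m, nm (v m) <= C) -> exists l : H, v @ \oo --> l.
Proof.
move=> Ev vC; pose a k := nm (v k) ^+ 2.
have diff k m : (n0 <= k)%N -> (k <= m)%N -> nm (v m - v k) ^+ 2 = a m - a k.
  move=> nk km; have vkm : rdot (v m) (v k) = a k.
    rewrite -{1}(Ev k k nk)// -(iter_cp_sym _ (@orthoproj_sym _ _ K)) (Ev k m)//.
    by rewrite -sqr_nm.
  rewrite sqr_nm !rdotE (rdotC (v k)) vkm -!sqr_nm -/(a m) -/(a k).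
  by ring.
pose A := [set a k | k in [set k | (n0 <= k)%N]].
have hA : has_sup A.
  split; first by exists (a n0), n0 => /=.
  exists (C ^+ 2) => _ [k _ <-]; rewrite /a ler_pXn2r ?nnegrE ?nm_ge0//.
  exact: le_trans (nm_ge0 _) (vC k).
apply: cauchy_nm_cvg => e e0.
have e2 : 0 < (e / 2) ^+ 2 by rewrite exprn_gt0// divr_gt0.
have [_ [N n0N <-] aN] := sup_adherent e2 hA.
have near m : (N <= m)%N -> nm (v m - v N) < e / 2.
  move=> Nm; rewrite -(@ltr_pXn2r _ 2) ?nnegrE ?nm_ge0 ?divr_ge0 ?(ltW e0)//.
  rewrite diff// ltrBlDr addrC -ltrBlDr (le_lt_trans _ aN)// lerB//.
  by apply: ub_le_sup; [case: hA|exists m => //=; exact: leq_trans Nm].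
exists N => m n /near Hm /near; rewrite nmB => Hn.
rewrite -(subrKA (v N)) (le_lt_trans (ler_nmD _ _))//; lra.
Qed.

Lemma iter_proj_limit : exists T, [/\ bounded_operator T, sigma T = T,
  forall x, (fun n => E n x) @ \oo --> T x
  & forall x, subspace_set K x -> T x = x].
Proof.
have P1 x : nm (P x) <= 1 * nm x.
  rewrite mul1r; have [->|P0] := eqVneq (nm (P x)) 0; first exact: nm_ge0.
  have P_gt0 : 0 < nm (P x) by rewrite lt_neqAle eq_sym P0 nm_ge0.
  rewrite -(ler_pM2r P_gt0) -expr2 sqr_nm orthoproj_rdot; last exact: orthoproj_in.
  exact: rdot_le_nm.
have E1 n x := iter_cp_le n ler01 P1 x.
have EL n : linear (E n).
  exact/operator_linear/iter_cp_bounded/orthoproj_bounded.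
have [||T Tb TE] := @strong_limit _ _ (fun n => E n) 1 setT EL ler01 E1.
- by move=> x; exact: subset_closure.
- move=> x _; apply: (@iter_proj_martingale _ (nm x) 0) => [k m _ km|m].
    by have [] := iter_proj_absorb x km.
  by have := E1 m x; rewrite mul1r.
exists T; split=> // [|x Kx]; first exact: iter_cp_limit_fixed TE.
apply: (cvg_nm_unique (TE x)).
rewrite (_ : (fun n => E n x) = fun _ => x); first exact: cvg_cst.
apply/funext => n; rewrite -{1}(orthoproj_id Kx).
by rewrite -[LHS]/((E n \o P) x) proj_iter_absorbr orthoproj_id.
Qed.

Hypothesis E_cvg : forall x, (fun n => E n x) @ \oo --> x.

Lemma fixed_lift Y : bounded_operator Y -> P \o sigma Y \o P = Y ->
  exists X, [/\ bounded_operator X, sigma X = X & P \o X \o P = Y].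
Proof.
move=> Yb PYP; have /bounded_nmP[YL [M M0 YM]] := Yb.
have XM n x := iter_cp_le n M0 YM x.
have XL n : linear (iter n sigma Y) by exact/operator_linear/iter_cp_bounded.
(* The dense set is the union of the ranges of the [E n]; a vector fixed by [E n] is fixed by every
   later [E k], which yields the martingale property from [n] on. *)
have [||X Xb XY] := @strong_limit _ _ (fun n => iter n sigma Y) M
    [set x | exists n, E n x = x] XL M0 XM.
- move=> x; apply/closure_nmP => e e0.
  have [N /(_ _ (leqnn N)) HN] := (cvg_nmP _ _).1 (@E_cvg x) _ e0.
  exists (E N x); last by rewrite nmB.
  by exists N; have [] := iter_proj_absorb x (leqnn N).
- move=> x [n Ex].
  have Ekx k : (n <= k)%N -> E k x = x.
    by move=> nk; rewrite -Ex; have [] := iter_proj_absorb x nk.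
  apply: (@iter_proj_martingale _ (M * nm x) n) => // k m nk km.
  by rewrite -{1}(Ekx k nk) iter_compress.
exists X; split=> //; first exact: iter_cp_limit_fixed XY.
apply/funext => x /=; apply: (@cvg_nm_unique _ _ (fun=> Y x)); last exact: cvg_cst.
have := cvg_operator (orthoproj_bounded K) (XY (P x)).
rewrite (_ : _ \o _ = fun=> Y x)//; apply/funext => n /=.
by rewrite -[LHS]/((P \o iter n sigma Y \o P) x) proj_compress.
Qed.

Lemma fixed_compress_scalar X c : bounded_operator X -> sigma X = X ->
  (forall x, P (X (P x)) = c *: P x) -> forall x, X x = c *: x.
Proof.
move=> Xb fX PXP.
have cZ : bounded_operator (fun x : H => c *: x).
  exact/bounded_scale/bounded_id.
have EXE n x : E n (X (E n x)) = c *: E n x.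
  have {1}-> : X = iter n sigma X by elim: n => //= n <-.
  rewrite !iter_cpE (_ : P \o X \o P = fun y => c *: P y); last exact/funext.
  elim: n x => //= n IH x; rewrite [RHS]scaler_sumr; apply: eq_bigr => i _.
  by rewrite IH (linZ (SL i)).
(* The two projections are removed one at a time: the left one is enlarged to [E (n + k)], which
   tends to 1, while the right one stays at [n]. *)
have XE n x : X (E n x) = c *: E n x.
  apply: (@cvg_nm_unique _ _ (fun k => E (n + k)%N (X (E n x)))).
    have h := (cvg_nmP _ _).1 (@E_cvg (X (E n x))).
    apply/cvg_nmP => e /h[N HN].
    by exists N => k Nk; apply: HN; rewrite (leq_trans Nk)// leq_addl.
  rewrite (_ : (fun k => _) = fun=> c *: E n x); first exact: cvg_cst.
  apply/funext => k; have [En En'] := iter_proj_absorb x (leq_addr k n).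
  by rewrite -En EXE.
move=> x; apply: (cvg_nm_unique (cvg_operator Xb (@E_cvg x))).
rewrite (_ : _ \o _ = fun n => c *: E n x); last by apply/funext => n /=.
exact: (cvg_operator cZ (@E_cvg x)).
Qed.

End CuntzFamily.

(** * Compression to the invariant subspace *)

Section Compression.
Context {R : realType} {H : hilbertType R} {d : nat} (S : 'I_d -> H -> H).
Variables (K : closed_subspace H) (V : 'I_d -> subspace_type K -> subspace_type K).
Hypotheses (Sb : forall i, bounded_operator (S i))
  (Ssum : forall x, \sum_(i < d) S i (adj (S i) x) = x)
  (KS : forall i x, subspace_set K x -> subspace_set K (adj (S i) x))
  (Vb : forall i, bounded_operator (V i))
  (Vadj : forall i (x : subspace_type K),
     val (adj (V i) x) = adj (S i) (orthoproj K (val x))).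
Local Notation P := (orthoproj K).

(** This is [P] with codomain [K], so [val \o Y \o into_subspace] is the operator [Y P] on [H]. *)
Definition into_subspace (x : H) : subspace_type K :=
  SubspaceElt (subspaceE (orthoproj_in K x)).

Lemma into_subspace_val x : into_subspace (val x) = x.
Proof. by apply/val_inj => /=; rewrite orthoproj_id//; exact: subspace_valW. Qed.

Lemma bounded_into_subspace : bounded_operator into_subspace.
Proof.
have /bounded_nmP[PL [M M0 PM]] := orthoproj_bounded K.
apply/bounded_nmP; split; last by exists M.
by move=> k x y; apply/val_inj; rewrite /= PL.
Qed.

Lemma bounded_val : bounded_operator (val : subspace_type K -> H).
Proof.
apply/bounded_nmP; split; first by move=> k x y; rewrite linearP.
by exists 1 => // x; rewrite mul1r.
Qed.

Lemma val_adjV i x : val (adj (V i) x) = adj (S i) (val x).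
Proof. by rewrite Vadj orthoproj_id//; exact: subspace_valW. Qed.

(** The adjoint form of the invariance of [K] under [adj (S i)]. *)
Lemma proj_cuntz i x : P (S i (P x)) = P (S i x).
Proof.
apply: orthoproj_eq => [|z Kz]; first exact: orthoproj_in.
rewrite orthoproj_rdot// !(adj_rdot _ _ (Sb i)) orthoproj_rdot//; exact: KS.
Qed.

Lemma val_V i x : val (V i x) = P (S i (val x)).
Proof.
apply/esym/orthoproj_eq => [|z Kz]; first exact: subspace_valW.
pose z' : subspace_type K := SubspaceElt (subspaceE Kz).
have h : rdot (val (V i x)) z = rdot (val x) (val (adj (V i) z')).
  exact: adj_rdot x z' (Vb i).
by rewrite h val_adjV adj_rdot.
Qed.

Lemma val_cpV Y x :
  val (cp_map V Y x) = P (cp_map S (val \o Y \o into_subspace) (val x)).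
Proof.
rewrite /cp_map (lin_sum (operator_linear (orthoproj_bounded K))).
rewrite (lin_sum (operator_linear bounded_val)); apply: eq_bigr => i _.
by rewrite val_V /= -val_adjV into_subspace_val.
Qed.

Lemma cpV_lift Y : cp_map V Y = Y ->
  P \o cp_map S (val \o Y \o into_subspace) \o P = val \o Y \o into_subspace.
Proof.
move=> fY; apply/funext => x /=.
by rewrite -[P x]/(val (into_subspace x)) -val_cpV fY.
Qed.

(** Both inner projections disappear: [adj (S i)] keeps vectors in [K], and [P S_i P = P S_i]. *)
Lemma cpV_compress X : cp_map S X = X ->
  cp_map V (into_subspace \o X \o val) = into_subspace \o X \o val.
Proof.
move=> fX; apply/funext => x; apply/val_inj; rewrite val_cpV /= -[in RHS]fX.
have PL := operator_linear (orthoproj_bounded K).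
rewrite /cp_map !(lin_sum PL); apply: eq_bigr => i _ /=.
rewrite [P (adj _ _)]orthoproj_id; first by rewrite proj_cuntz.
by apply: KS; exact: subspace_valW.
Qed.

Lemma V_unital x : \sum_(i < d) V i (adj (V i) x) = x.
Proof.
apply/val_inj; rewrite (lin_sum (operator_linear bounded_val)).
under eq_bigr do rewrite val_V val_adjV.
rewrite -(lin_sum (operator_linear (orthoproj_bounded K))) Ssum.
by rewrite orthoproj_id//; exact: subspace_valW.
Qed.

(** The projection onto an invariant [W] commutes with every [adj (V i)], so by unitality it is a
    fixed point, hence a scalar; a nonzero vector of [W] makes that scalar 1. *)
Lemma fixed_scalar_irreducible :
  (forall Y, bounded_operator Y -> cp_map V Y = Y -> is_scalar Y) ->
  acts_irreducibly ([set V i | i in setT] `|` [set adj (V i) | i in setT]).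
Proof.
move=> scal W WT.
have WV i x : subspace_set W x -> subspace_set W (V i x).
  by apply: WT; left; exists i.
have WV' i x : subspace_set W x -> subspace_set W (adj (V i) x).
  by apply: WT; right; exists i.
have QV i x : orthoproj W (adj (V i) x) = adj (V i) (orthoproj W x).
  apply: orthoproj_comm => [|y|y]; first exact: adj_bounded.
    exact: WV'.
  by rewrite adjK//; exact: WV.
have [||c Qc] := scal (orthoproj W).
- exact: orthoproj_bounded.
- apply/funext => x; rewrite /cp_map; under eq_bigr do rewrite QV.
  exact: V_unital.
have [[w [Ww w0]]|W0] := pselect (exists w, subspace_set W w /\ w <> 0); last first.
  left; apply/seteqP; split=> [w Ww /=|_ ->]; last exact: subspace0.
  by apply: contrapT => w0; apply: W0; exists w.
right; apply/seteqP; split=> // x _.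
have c1 : c = 1.
  have := Qc w; rewrite orthoproj_id// => /eqP.
  rewrite -subr_eq0 -{1}[w]scale1r -scalerBl scaler_eq0 => /orP[|/eqP//].
  by rewrite subr_eq0 => /eqP.
by have := Qc x; rewrite c1 scale1r => <-; exact: orthoproj_in.
Qed.

(** As [T] commutes with [P], it restricts to [K], where it commutes with the [V i] and their
    adjoints; Schur's lemma applies to the restriction. *)
Lemma irreducible_commutant (T : H -> H) x :
  acts_irreducibly ([set V i | i in setT] `|` [set adj (V i) | i in setT]) ->
  bounded_operator T -> (forall x y, rdot (T x) y = rdot x (T y)) ->
  (forall x, T (P x) = P (T x)) -> (forall i x, T (S i x) = S i (T x)) ->
  (forall i x, T (adj (S i) x) = adj (S i) (T x)) ->
  subspace_set K x -> exists c : R[i], T x = c *: x.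
Proof.
move=> irr Tb Tsym TP TS TS' Kx.
pose Y (y : subspace_type K) := into_subspace (T (val y)).
have valY y : val (Y y) = T (val y).
  by rewrite /= -TP orthoproj_id//; exact: subspace_valW.
have [|||_ [[i _ <-]|[i _ <-]] y|c Yc] := @schur _ _ _ Y irr.
- move=> _ [[i _ <-]|[i _ <-]] //; exact: adj_bounded.
- exact: (bounded_comp (bounded_comp bounded_into_subspace Tb) bounded_val).
- move=> y z; rewrite -[LHS]/(rdot (val (Y y)) (val z)).
  by rewrite -[RHS]/(rdot (val y) (val (Y z))) !valY Tsym.
- by apply/val_inj; rewrite valY !val_V valY TP TS.
- by apply/val_inj; rewrite valY !val_adjV valY TS'.
exists c; have := Yc (SubspaceElt (subspaceE Kx)).
by move=> /(congr1 val); rewrite valY.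
Qed.

End Compression.

(** * Purity, fixed points and irreducibility compared *)

Theorem theorem4p4 (R : realType) (d : nat) (hd : (2 <= d)%N)
    (A : cstarAlgType R) (s : 'I_d -> A) (hA : is_cuntz_algebra s)
    (omega : {scalar A}) (homega : is_state omega)
    (H : hilbertType R) (Omega : H) (pi : A -> H -> H)
    (hpi : is_gns omega Omega pi)
    (S : 'I_d -> H -> H) (hS : forall i, S i = pi (s i))
    (K : closed_subspace H)
    (hK : K = closed_span [set adj_word S I Omega | I in [set: seq 'I_d]])
    (P : H -> H) (hP : P = orthoproj K)
    (V : 'I_d -> subspace_type K -> subspace_type K)
    (hV : forall i, bounded_operator (V i))
    (hVadj : forall i (x : subspace_type K),
       val (adj (V i) x) = adj (S i) (P (val x))) :
  [<-> is_pure omega;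
       forall X : H -> H, bounded_operator X ->
         cp_map S X = X -> is_scalar X;
       forall Y : subspace_type K -> subspace_type K, bounded_operator Y ->
         cp_map V Y = Y -> is_scalar Y;
       acts_irreducibly ([set V i | i in setT] `|` [set adj (V i) | i in setT])
       /\ commutant (commutant (range pi)) P].
Proof.
subst P; have [[SS0 Ssum0] gen _] := hA.
have adjS i : adj (S i) = pi (star (s i)) by rewrite hS (gns_star hpi).
have Sb i : bounded_operator (S i) by rewrite hS; exact: (gns_bounded hpi).
have Sb' i := adj_bounded (Sb i).
have piL x : linear (pi ^~ x) := gns_linear hpi x.
have SS i j x : adj (S i) (S j x) = (i == j)%:R *: x.
  rewrite adjS hS -(gnsM hpi) SS0; case: eqP => _.
    by rewrite (gns1 hpi) scale1r.
  by rewrite (lin0 (piL x)) scale0r.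
have Ssum x : \sum_(i < d) S i (adj (S i) x) = x.
  rewrite -[RHS](gns1 hpi) -Ssum0 (lin_sum (piL x)); apply: eq_bigr => i _.
  by rewrite adjS hS (gnsM hpi).
have KO : subspace_set K Omega.
  by rewrite hK; apply: closed_span_sub; exists [::].
have KS i x : subspace_set K x -> subspace_set K (adj (S i) x).
  rewrite {1}hK; apply: closed_span_map => // _ [I _ <-].
  (* The last letter of a word acts outermost, so applying [adj (S i)] appends [i]. *)
  rewrite hK; apply: closed_span_sub; exists (rcons I i) => //.
  by rewrite /adj_word foldl_rcons.
have fixed_commutant X : bounded_operator X -> cp_map S X = X ->
    forall a x, X (pi a x) = pi a (X x).
  move=> Xb fX; apply: (gns_generated homega hpi gen Xb) => i x.
    rewrite -hS.
    by have [] := fixed_commutes Sb SS (operator_linear Xb) fX i x.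
  rewrite -adjS.
  by have [] := fixed_commutes Sb SS (operator_linear Xb) fX i x.
have commutant_fixed X : (forall a x, X (pi a x) = pi a (X x)) -> cp_map S X = X.
  by move=> XC; apply: commutes_fixed => // i x; rewrite adjS XC.
(* The strong limit is fixed by [sigma], hence commutes with [pi], and it fixes [Omega], which lies
   in [K]; cyclicity makes it the identity. *)
have E_cvg x : (fun n => iter n (cp_map S) (orthoproj K) x) @ \oo --> x.
  have [T [Tb fT TE TK]] := iter_proj_limit Sb SS Ssum KS.
  have T1 := gns_commutant_scalar hpi Tb (fixed_commutant _ Tb fT) (c := 1).
  have Tx : T x = x by rewrite T1 ?TK ?scale1r.
  by have := TE x; rewrite Tx.
tfae.
- move=> pure X Xb fX.
  exact: (pure_commutant homega hpi pure Xb (fixed_commutant _ Xb fX)).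
- move=> scal Y Yb fY.
  have Yb' := bounded_comp (bounded_comp (bounded_val K) Yb) (bounded_into_subspace K).
  have [X [Xb fX PXP]] := fixed_lift Sb SS Ssum KS E_cvg Yb'
    (cpV_lift Sb hV hVadj fY).
  have [c Xc] := scal X Xb fX; exists c => x; apply/val_inj.
  have := congr1 (fun f => f (val x)) PXP; rewrite /= into_subspace_val => <-.
  have Px := orthoproj_id (subspace_valW x).
  by rewrite Px Xc (linZ (operator_linear (orthoproj_bounded K))) Px.
- move=> scal; split; first exact: (fixed_scalar_irreducible Sb Ssum hV hVadj).
  split=> [|X [Xb XC]]; first exact: orthoproj_bounded.
  (* An [X] in the commutant is fixed by [sigma]. Its compression to [K] is scalar by (iii), so [X]
     is scalar and commutes with [P]. *)
  have fX : cp_map S X = X.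
    apply: commutant_fixed => a x.
    by have /(congr1 (@^~ x)) := XC (pi a) (imageT pi a).
  have [c Yc] := scal _
    (bounded_comp (bounded_comp (bounded_into_subspace K) Xb) (bounded_val K))
    (cpV_compress Sb KS hV hVadj fX).
  have Xc := fixed_compress_scalar Sb SS Ssum KS E_cvg Xb fX (c := c).
  apply/funext => x /=; rewrite !Xc ?(linZ (operator_linear (orthoproj_bounded K)))//.
    by move=> y; have /(congr1 val) := Yc (into_subspace K y).
  by move=> y; have /(congr1 val) := Yc (into_subspace K y).
- move=> [irr [_ PC]]; split=> // f1 f2 t f1S f2S /andP[t0 t1] omegaE.
  have [f1_ge0 f11 _] := f1S; have [f2_ge0 f21 _] := f2S.
  (* The decomposition gives [t * f1 <= omega] on the elements [star a * a], whence the constant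
     [t^-1]. *)
  have [||T [Tb Tsym TC Tf]] := dominated_operator hpi f1S (K := t^-1).
  + by rewrite invr_ge0 ltW.
  + move=> a; rewrite (gns_sqr_nm hpi) omegaE ReD !ReZ ler_pdivlMl//.
    by rewrite lerDl mulr_ge0 ?subr_ge0 ?(ltW t1)// Re_ge0.
  have TP x : T (orthoproj K x) = orthoproj K (T x).
    have /PC/(congr1 (@^~ x)) // : commutant (range pi) T.
    by split=> // _ [a _ <-]; apply/funext => y /=; rewrite TC.
  have [||c TO] := irreducible_commutant Sb hV hVadj irr Tb Tsym TP _ _ KO.
  + by move=> i x; rewrite hS TC.
  + by move=> i x; rewrite adjS TC.
  have f1c a : f1 a = c * omega a.
    by rewrite Tf TC TO (linZ (operator_linear (gns_bounded hpi a))) hdotZl -(gnsE hpi).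
  (* Both functionals take the value 1 at the unit. *)
  have c1 : c = 1.
    by have := f1c 1; have [_ -> _] := homega; rewrite f11 mulr1.
  have f1E : f1 =1 omega by move=> a; rewrite f1c c1 mul1r.
  (* With [f1 = omega], the decomposition reads [(1 - t) omega = (1 - t) f2], and [1 - t] is
     nonzero. *)
  split=> // a; have := omegaE a; rewrite f1E => /eqP.
  rewrite addrC -subr_eq -{1}[omega a]mul1r -mulrBl -(rmorph1 (real_complex R)).
  rewrite -rmorphB /= => /eqP /mulfI ->//.
  by rewrite eq_complex /= eqxx andbT subr_eq0 gt_eqF.
Qed.
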